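(* Let $R$ be a field of characteristic $0$, $r\ge2$, $n\ge3$, and let $\Lambda=\Lambda_{j_1}+\dots+\Lambda_{j_r}$ be a dominant weight with $|j_a-j_b|>2$ for $a\ne b$. Let $1\le u<v\le r$ and let $\lambda,\mu\in\mathfrak B_n^{(r)}-\mathfrak D_n^{(r)}$ be two one-column $r$-partitions of $n$ all of whose components except for the $u$-th and $v$-th are empty. Let $\Lambda'=\Lambda_{j_u}+\Lambda_{j_v}$, $\lambda'=(\lambda^{(u)},\lambda^{(v)})$ and $\mu'=(\mu^{(u)},\mu^{(v)})$. Then $$[W(\lambda),L(\mu)]=[W(\lambda'),L(\mu')]_{TLB},$$ where the left-hand side is the decomposition number (composition multiplicity of the simple module in the cell module) for $TL_{r,1,n}^{\Lambda}$ and the right-hand side is that for $TLB_n^{\Lambda'}$.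
   Context: Weights. $q\in R^*$, $q\neq1$; $e$ is the smallest positive integer with $1+q+\dots+q^{e-1}=0$, and $e=0$ if none exists; $I=\mathbb{Z}/e\mathbb{Z}$. For $a,b\in I$, $|a-b|:=\min\{|c-d| : c,d\in\mathbb{Z},\ c\equiv a,\ d\equiv b \bmod e\}$. The $\Lambda_i$ are fundamental weights and $\alpha_i$ simple roots ($i\in I$), with $(\Lambda_i,\alpha_j)=\delta_{ij}$. The hypotheses on $\Lambda$ force $e=0$ or $e\ge 6$. Write $i\to j$ (also $j\leftarrow i$) if $j=i+1$. KLR algebra. $\mathfrak S_n$ acts on $I^n$ by place permutation, $s_k$ swapping entries $k,k+1$. For each $\mathfrak S_n$-orbit $O\subseteq I^n$ let $\mathcal R_O^\Lambda$ be the unital associative $R$-algebra with generators $\psi_1,\dots,\psi_{n-1},y_1,\dots,y_n,e(\mathbf i)$ ($\mathbf i=(i_1,\dots,i_n)\in O$) and relations: $y_1^{(\Lambda,\alpha_{i_1})}e(\mathbf i)=0$; $e(\mathbf i)e(\mathbf j)=\delta_{\mathbf i\mathbf j}e(\mathbf i)$; $\sum_{\mathbf i\in O} e(\mathbf i)=1$; $e(\mathbf i)y_k=y_ke(\mathbf i)$; $\psi_ke(\mathbf i)=e(s_k\mathbf i)\psi_k$; $y_ky_l=y_ly_k$; $\psi_ky_l=y_l\psi_k$ if $l\ne k,k+1$; $\psi_k\psi_l=\psi_l\psi_k$ if $|k-l|\ne1$; $\psi_ky_{k+1}e(\mathbf i)=(y_k\psi_k+\delta_{i_k,i_{k+1}})e(\mathbf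 i)$; $y_{k+1}\psi_ke(\mathbf i)=(\psi_ky_k+\delta_{i_k,i_{k+1}})e(\mathbf i)$; $\psi_k^2e(\mathbf i)$ equals $0$ if $i_k=i_{k+1}$, $(y_{k+1}-y_k)e(\mathbf i)$ if $i_k\to i_{k+1}$, $(y_k-y_{k+1})e(\mathbf i)$ if $i_k\leftarrow i_{k+1}$, and $e(\mathbf i)$ otherwise; $(\psi_k\psi_{k+1}\psi_k-\psi_{k+1}\psi_k\psi_{k+1})e(\mathbf i)$ equals $e(\mathbf i)$ if $i_{k+2}=i_k\to i_{k+1}$, $-e(\mathbf i)$ if $i_{k+2}=i_k\leftarrow i_{k+1}$, and $0$ otherwise. Put $\mathcal R_n^\Lambda=\bigoplus_O\mathcal R_O^\Lambda$ (only finitely many summands are nonzero); $\psi_k,y_k$ also denote the sums of the corresponding elements over all $O$. $*$ is the $R$-linear anti-automorphism fixing all generators. Temperley-Lieb quotients. $\mathcal J_n=\mathcal J_n(\Lambda)$ is the two-sided ideal of $\mathcal R_n^\Lambda$ generated by all $e(\mathbf i)$ with $(\alpha_{i_1},\Lambda)>0$ and $i_2=i_1+1$, and all $e(\mathbf i)$ with $i_1,i_2,i_3$ pairwise distinct and $(\alpha_{i_a},\Lambda)>0$ for $a=1,2,3$. $TL_{r,1,n}^\Lambda=\mathcal R_n^\Lambda/\mathcal J_n(\Lambda)$, and $TLB_n^{\Lambda'}=\mathcal R_n^{\Lambda'}/\mathcal J_n(\Lambda')$ is the same construction for $\Lambda'$ (with $r=2$). Combinatorics. A one-column $r$-partition $\lambda=(\lambda^{(1)},\dots,\lambda^{(r)})$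 of $n$ is an $r$-tuple of one-column partitions of total size $n$, identified with its set of nodes $[\lambda]=\{(a,1,l):1\le l\le r,\ 1\le a\le|\lambda^{(l)}|\}$. $\mathfrak B_n^{(r)}$ is the set of these and $\mathfrak D_n^{(r)}$ the subset of those with at least three non-empty components. Nodes are totally ordered by $(a,1,l)<(a',1,l')$ iff $a<a'$, or $a=a'$ and $l<l'$. $\lambda\unlhd\mu$ iff for every node $\gamma_0\in\mathbb N\times\{1\}\times\{1,\dots,r\}$, $|\{\gamma\in[\lambda]:\gamma\le\gamma_0\}|\ge|\{\gamma\in[\mu]:\gamma\le\gamma_0\}|$. A tableau of shape $\lambda$ is a bijection $t:\{1,\dots,n\}\to[\lambda]$; it is standard if the numbers increase down each column; $Std(\lambda)$ is the set of standard ones. $t^\lambda$ is the tableau with $t^\lambda(1)<\dots<t^\lambda(n)$; $d(t)\in\mathfrak S_n$ is defined by $t=t^\lambda\circ d(t)$. The residue of $(a,1,l)$ is $1-a+j_l\in I$; $e_\lambda=e(\mathbf i)$ where $i_k$ is the residue of $t^\lambda(k)$. For bipartitions the residues are computed with $(j_u,j_v)$ in place of $(j_1,\dots,j_r)$. Cell and simple modules. For each $t\in Std(\lambda)$ fix a reduced expression $d(t)=s_{i_1}\cdots s_{i_k}$ and put $\psi_{d(t)}=\psi_{i_1}\cdots\psi_{i_k}$; the family is chosen ''official'': deleting the last letter of the word for $d(t)\ne1$ gives the chosen word for $d(s)$ for some $s\in Std(\lambda)$. The images of $C_{s,t}^\lambda=\psi_{d(s)}^*e_\lambda\psi_{d(t)}$,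 $\lambda\in\mathfrak B_n^{(r)}-\mathfrak D_n^{(r)}$, $s,t\in Std(\lambda)$, form a cellular basis of $TL_{r,1,n}^\Lambda$ with respect to $\unlhd$. $W(\lambda)$ is the left module with basis $\{C_s:s\in Std(\lambda)\}$ and $aC_s=\sum_{s'}r_a(s',s)C_{s'}$, where $aC_{s,t}^\lambda\equiv\sum_{s'}r_a(s',s)C_{s',t}^\lambda$ modulo the span of the $C^\nu_{x,y}$ with $\nu\triangleleft\lambda$. The bilinear form $\phi_\lambda$ on $W(\lambda)$ is defined by $C^\lambda_{s',t}C^\lambda_{s,t'}\equiv\phi_\lambda(C_t,C_s)C^\lambda_{s',t'}$ modulo the same span, and $L(\lambda)=W(\lambda)/\mathrm{rad}(\phi_\lambda)$. The same definitions with $(2,\Lambda')$ in place of $(r,\Lambda)$ give the modules $W(\lambda')$, $L(\mu')$ of $TLB_n^{\Lambda'}$. *)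

(* Defs.v *)
From HB Require Import structures.
From mathcomp Require Import all_boot all_order all_fingroup all_algebra.
From mathcomp Require Import zify.
From mathcomp Require Import boolp classical_sets.
From mathcomp.multinomials Require Import -(notations) monalg.

Set Implicit Arguments.
Unset Strict Implicit.
Unset Printing Implicit Defensive.

Import GRing.Theory.
Local Open Scope ring_scope.
Local Open Scope quotient_scope.

(* A unital associative [R]-algebra is a ring with a ring morphism
   [scal : R -> A] into its centre; the scalar multiple c.x is [scal c * x].
   [algType] is not used because it excludes the zero ring: the algebra of an
   orbit below may be zero. *)
HB.mixin Record PzRing_isPzAlgebra (R : pzRingType) A of GRing.PzRing A := {
  scal : R -> A;
  scalB : zmod_morphism scal;
  scalM : monoid_morphism scal;
  scalC : forall (c : R) (x : A), scal c * x = x * scal c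
}.

#[short(type="pzAlgType")]
HB.structure Definition PzAlgebra (R : pzRingType) :=
  {A of GRing.PzRing A & PzRing_isPzAlgebra R A}.

Arguments scal {R s} _.

HB.instance Definition _ (R : pzRingType) (A : pzAlgType R) :=
  GRing.isZmodMorphism.Build R A scal scalB.
HB.instance Definition _ (R : pzRingType) (A : pzAlgType R) :=
  GRing.isMonoidMorphism.Build R A scal scalM.

Inductive gen_ideal (A : pzRingType) (S : A -> Prop) : A -> Prop :=
| GenIdealIn x : S x -> gen_ideal S x
| GenIdeal0 : gen_ideal S 0
| GenIdealB x y : gen_ideal S x -> gen_ideal S y -> gen_ideal S (x - y)
| GenIdealMl a x : gen_ideal S x -> gen_ideal S (a * x)
| GenIdealMr x a : gen_ideal S x -> gen_ideal S (x * a).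

Section AlgebraQuotient.
Variables (R : pzRingType) (A : pzAlgType R) (S : A -> Prop).

Definition ideal_pred : pred A := fun x => `[< gen_ideal S x >].

Lemma ideal_pred_zmod_closed : zmod_closed ideal_pred.
Proof.
split=> [|x y]; first exact/asboolP/GenIdeal0.
by move=> /asboolP Ix /asboolP Iy; apply/asboolP/GenIdealB.
Qed.

HB.instance Definition _ :=
  GRing.isZmodClosed.Build A ideal_pred ideal_pred_zmod_closed.

Definition ideal_zmod : zmodClosed A := GRing.ZmodClosed.clone A ideal_pred _.
Definition alg_quot : Type := Quotient.quot ideal_zmod.
HB.instance Definition _ := Choice.on alg_quot.
HB.instance Definition _ := GRing.Zmodule.on alg_quot.

Definition to_quot (x : A) : alg_quot := \pi_(Quotient.quot ideal_zmod) x.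
Definition of_quot (x : alg_quot) : A := generic_quotient.repr (x : Quotient.quot ideal_zmod).

Lemma of_quotK x : to_quot (of_quot x) = x.
Proof. exact: reprK. Qed.

Lemma to_quotP x y : to_quot x = to_quot y <-> gen_ideal S (x - y).
Proof.
have -> : gen_ideal S (x - y) <-> (x - y \in ideal_zmod).
  by split=> /asboolP.
by rewrite Quotient.idealrBE; split => [/eqP|/eqP].
Qed.

Lemma to_quotD x y : to_quot (x + y) = to_quot x + to_quot y.
Proof. by rewrite /to_quot !piE. Qed.

Lemma to_quotB x y : to_quot (x - y) = to_quot x - to_quot y.
Proof. by rewrite /to_quot !piE. Qed.

Lemma to_quot0 : to_quot 0 = 0.
Proof. by rewrite /to_quot !piE. Qed.

Definition quot1 : alg_quot := to_quot 1.
Definition quotM (x y : alg_quot) : alg_quot :=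
  to_quot (of_quot x * of_quot y).
Lemma of_quot_ideal x : gen_ideal S (of_quot (to_quot x) - x).
Proof. by apply/to_quotP; rewrite of_quotK. Qed.

Lemma to_quotM x y : to_quot (x * y) = quotM (to_quot x) (to_quot y).
Proof.
apply/esym/to_quotP.
set x' := of_quot _; set y' := of_quot _.
have -> : x' * y' - x * y = (x' - x) * y' - x * - (y' - y).
  by rewrite mulrN opprK mulrBl mulrBr addrA subrK.
apply: GenIdealB; first exact/GenIdealMr/of_quot_ideal.
apply: GenIdealMl; rewrite -sub0r; apply: GenIdealB (GenIdeal0 _) _.
exact: of_quot_ideal.
Qed.

Lemma quotMA : associative quotM.
Proof.
move=> x y z; rewrite -(of_quotK x) -(of_quotK y) -(of_quotK z).
by rewrite -!to_quotM mulrA.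
Qed.
Lemma quot1M : left_id quot1 quotM.
Proof. by move=> x; rewrite -(of_quotK x) -to_quotM mul1r. Qed.
Lemma quotM1 : right_id quot1 quotM.
Proof. by move=> x; rewrite -(of_quotK x) -to_quotM mulr1. Qed.
Lemma quotMDl : left_distributive quotM +%R.
Proof.
move=> x y z; rewrite -(of_quotK x) -(of_quotK y) -(of_quotK z).
by rewrite -to_quotD -!to_quotM mulrDl to_quotD.
Qed.
Lemma quotMDr : right_distributive quotM +%R.
Proof.
move=> x y z; rewrite -(of_quotK x) -(of_quotK y) -(of_quotK z).
by rewrite -to_quotD -!to_quotM mulrDr to_quotD.
Qed.

HB.instance Definition _ := GRing.Zmodule_isPzRing.Build alg_quot
  quotMA quot1M quotM1 quotMDl quotMDr.

Lemma to_quot_is_zmod_morphism : zmod_morphism to_quot.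
Proof. exact: to_quotB. Qed.
HB.instance Definition _ := GRing.isZmodMorphism.Build A alg_quot to_quot
  to_quot_is_zmod_morphism.
Lemma to_quot_is_monoid_morphism : monoid_morphism to_quot.
Proof. by split=> // x y; apply: to_quotM. Qed.
HB.instance Definition _ := GRing.isMonoidMorphism.Build A alg_quot to_quot
  to_quot_is_monoid_morphism.
Definition quot_scal (c : R) : alg_quot := to_quot (scal c).
Lemma quot_scalB : zmod_morphism quot_scal.
Proof. by move=> a b; rewrite /quot_scal !rmorphB. Qed.
Lemma quot_scalM : monoid_morphism quot_scal.
Proof. by split=> [|a b]; rewrite /quot_scal ?rmorph1 ?rmorphM. Qed.
Lemma quot_scalC (c : R) (x : alg_quot) : quot_scal c * x = x * quot_scal c.
Proof. by rewrite -(of_quotK x) -!rmorphM scalC. Qed.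
HB.instance Definition _ := PzRing_isPzAlgebra.Build R alg_quot
  quot_scalB quot_scalM quot_scalC.

End AlgebraQuotient.

Section FreeAlgebra.
Variables (R : comNzRingType) (X : choiceType).

Definition free_alg : Type := monalg.malg (monalg.fmonom X) R.
HB.instance Definition _ := GRing.NzRing.on free_alg.

Definition fgen (x : X) : free_alg := monalg.mkmalgU (monalg.fmu x) 1.

Definition free_scal (c : R) : free_alg := monalg.malgC c.
Lemma free_scalB : zmod_morphism free_scal.
Proof. exact: raddfB. Qed.
Lemma free_scalM : monoid_morphism free_scal.
Proof. by split=> [|a b]; [exact: rmorph1|exact: rmorphM]. Qed.
Lemma free_scalC (c : R) (x : free_alg) : free_scal c * x = x * free_scal c.
Proof.
rewrite [LHS]monalg.fgmulUg [RHS]monalg.fgmulgU.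
by apply: eq_bigr => k _; rewrite monalg.mul1m monalg.mulm1 mulrC.
Qed.
HB.instance Definition _ := PzRing_isPzAlgebra.Build R free_alg
  free_scalB free_scalM free_scalC.

End FreeAlgebra.

Arguments fgen {R X} x.

Section DirectProduct.
Variables (R : pzRingType) (K : Type) (A : K -> pzAlgType R).

Definition dprod : Type := forall k, A k.
HB.instance Definition _ := gen_eqMixin dprod.
HB.instance Definition _ := gen_choiceMixin dprod.

Implicit Types x y z : dprod.
Definition dprod0 : dprod := fun k => 0.
Definition dprodN x : dprod := fun k => - x k.
Definition dprodD x y : dprod := fun k => x k + y k.
Definition dprod1 : dprod := fun k => 1.
Definition dprodM x y : dprod := fun k => x k * y k.
Lemma dprodDA : associative dprodD.
Proof. by move=> x y z; apply/functional_extensionality_dep=> k; apply: addrA. Qed.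
Lemma dprodDC : commutative dprodD.
Proof. by move=> x y; apply/functional_extensionality_dep=> k; apply: addrC. Qed.
Lemma dprod0D : left_id dprod0 dprodD.
Proof. by move=> x; apply/functional_extensionality_dep=> k; apply: add0r. Qed.
Lemma dprodND : left_inverse dprod0 dprodN dprodD.
Proof. by move=> x; apply/functional_extensionality_dep=> k; apply: addNr. Qed.
HB.instance Definition _ := GRing.isZmodule.Build dprod
  dprodDA dprodDC dprod0D dprodND.

Lemma dprodMA : associative dprodM.
Proof. by move=> x y z; apply/functional_extensionality_dep=> k; apply: mulrA. Qed.
Lemma dprod1M : left_id dprod1 dprodM.
Proof. by move=> x; apply/functional_extensionality_dep=> k; apply: mul1r. Qed.
Lemma dprodM1 : right_id dprod1 dprodM.
Proof. by move=> x; apply/functional_extensionality_dep=> k; apply: mulr1. Qed.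
Lemma dprodMDl : left_distributive dprodM +%R.
Proof. by move=> x y z; apply/functional_extensionality_dep=> k; apply: mulrDl. Qed.
Lemma dprodMDr : right_distributive dprodM +%R.
Proof. by move=> x y z; apply/functional_extensionality_dep=> k; apply: mulrDr. Qed.
HB.instance Definition _ := GRing.Zmodule_isPzRing.Build dprod
  dprodMA dprod1M dprodM1 dprodMDl dprodMDr.

Definition dprod_scal (c : R) : dprod := fun k => scal c.
Lemma dprod_scalB : zmod_morphism dprod_scal.
Proof. by move=> a b; apply/functional_extensionality_dep=> k; apply: rmorphB. Qed.
Lemma dprod_scalM : monoid_morphism dprod_scal.
Proof.
by split=> [|a b]; apply/functional_extensionality_dep=> k;
  [apply: rmorph1|apply: rmorphM].
Qed.
Lemma dprod_scalC (c : R) x : dprod_scal c * x = x * dprod_scal c.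
Proof. by apply/functional_extensionality_dep=> k; apply: scalC. Qed.
HB.instance Definition _ := PzRing_isPzAlgebra.Build R dprod
  dprod_scalB dprod_scalM dprod_scalC.

End DirectProduct.

(* [e] is the smallest positive integer with [1 + q + ... + q^(e-1) = 0], and
   [0] if there is none. *)
Definition is_quantum_char (R : fieldType) (q : R) (e : nat) : Prop :=
  let vanishes m := \sum_(i < m) q ^+ i = 0 in
  if (0 < e)%N then vanishes e /\ forall m, (0 < m < e)%N -> ~ vanishes m
  else forall m, (0 < m)%N -> ~ vanishes m.

(* [I = Z/eZ]; in particular [Zmod 0] is a copy of [int]. *)
Definition Zmod (e : nat) : Type :=
  Quotient.quot (GRing.ZmodClosed.clone int (dvdz e) _).
HB.instance Definition _ e := Choice.on (Zmod e).
HB.instance Definition _ e := GRing.Zmodule.on (Zmod e).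

Section Residues.
Variable e : nat.

Definition cls (c : int) : Zmod e :=
  \pi_(Quotient.quot (GRing.ZmodClosed.clone int (dvdz e) _)) c.

Lemma cls_is_zmod_morphism : zmod_morphism cls.
Proof. by move=> c d; rewrite /cls raddfB. Qed.
HB.instance Definition _ := GRing.isZmodMorphism.Build int (Zmod e) cls
  cls_is_zmod_morphism.

Lemma cls_surj (a : Zmod e) : exists c, cls c = a.
Proof. by exists (generic_quotient.repr (a : Quotient.quot _)); apply: reprK. Qed.

Definition is_rep_dist (a b : Zmod e) : pred nat := fun m =>
  `[< exists c d : int, [/\ cls c = a, cls d = b & `|c - d|%N = m] >].

Lemma is_rep_dist_ex a b : exists m, is_rep_dist a b m.
Proof.
have [c ca] := cls_surj a; have [d db] := cls_surj b.
by exists `|c - d|%N; apply/asboolP; exists c, d.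
Qed.

Definition Idist (a b : Zmod e) : nat := ex_minn (is_rep_dist_ex a b).

Definition arrow (i j : Zmod e) : bool := j == i + cls 1.

(* A dominant weight [L] is given by the numbers [(L, alpha_i)]. *)
Definition weight : Type := Zmod e -> nat.
Definition fund_weight (i : Zmod e) : weight := fun k => (i == k).
Definition sum_fund_weights r (j : 'I_r -> Zmod e) : weight :=
  fun k => \sum_(a < r) fund_weight (j a) k.

End Residues.

(* [k : 'I_n.-1] is the index of [s_k] and [psi_k]; [lo k] and [hi k] are the
   two places [k] and [k + 1]. All indices start at [0] instead of [1]. *)
Lemma lo_subproof n (k : 'I_n.-1) : (k < n)%N.
Proof. exact: leq_trans (ltn_ord k) (leq_pred n). Qed.
Lemma hi_subproof n (k : 'I_n.-1) : (k.+1 < n)%N.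
Proof. by case: n k => [|n] k; [case: k|rewrite ltnS]. Qed.
Definition lo n (k : 'I_n.-1) : 'I_n := Ordinal (lo_subproof k).
Definition hi n (k : 'I_n.-1) : 'I_n := Ordinal (hi_subproof k).
Definition simple_refl n (k : 'I_n.-1) : 'S_n := tperm (lo k) (hi k).

Section Orbits.
Variables (e n : nat).

Definition Iseq : Type := {ffun 'I_n -> Zmod e}.
HB.instance Definition _ := Choice.on Iseq.

Implicit Types (i j : Iseq) (s : 'S_n).

Definition place_perm s i : Iseq := [ffun k => i (s k)].

Definition same_orbit i j : bool := [exists s, j == place_perm s i].

Lemma same_orbitP i j : reflect (exists s, j = place_perm s i) (same_orbit i j).
Proof. exact: exists_eqP. Qed.

Lemma place_perm1 i : place_perm 1%g i = i.
Proof. by apply/ffunP=> k; rewrite ffunE perm1. Qed.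

Lemma place_permM s t i : place_perm s (place_perm t i) = place_perm (s * t)%g i.
Proof. by apply/ffunP=> k; rewrite !ffunE permM. Qed.

Lemma same_orbit_equiv : equiv_class_of same_orbit.
Proof.
split=> [i|i j|j i k].
- by apply/same_orbitP; exists 1%g; rewrite place_perm1.
- by apply/same_orbitP/same_orbitP => -[s ->]; exists s^-1%g;
    rewrite place_permM mulVg place_perm1.
- move=> /same_orbitP[s ->] /same_orbitP[t ->].
  by apply/same_orbitP; exists (t * s)%g; rewrite place_permM.
Qed.

Canonical same_orbit_rel := EquivRelPack same_orbit_equiv.
Canonical same_orbit_enc := defaultEncModRel same_orbit.

Definition Orbit : Type := {eq_quot same_orbit}.
HB.instance Definition _ := Choice.on Orbit.

Definition orbit_of i : Orbit := \pi_({eq_quot same_orbit}) i.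

Definition orbit_seq (O : Orbit) : seq Iseq :=
  undup [seq place_perm s (generic_quotient.repr (O : {eq_quot same_orbit}))
        | s <- enum {: 'S_n}].

Lemma mem_orbit_seq O i : (i \in orbit_seq O) = (orbit_of i == O).
Proof.
rewrite mem_undup; apply/mapP/eqP => [[s _ ->]|<-].
  rewrite -[RHS]reprK; apply/eqP; rewrite eqmodE.
  apply/same_orbitP; exists s^-1%g.
  by rewrite place_permM mulVg place_perm1.
have : same_orbit (generic_quotient.repr (orbit_of i : {eq_quot same_orbit})) i.
  by rewrite -eqmodE reprK.
by case/same_orbitP=> s i_s; exists s; rewrite ?mem_enum.
Qed.

Definition in_orbit (O : Orbit) : Type := seq_sub (orbit_seq O).
HB.instance Definition _ O := Finite.on (in_orbit O).
HB.instance Definition _ O := SubType.on (in_orbit O).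

Lemma swap_subproof O (k : 'I_n.-1) (i : in_orbit O) :
  place_perm (simple_refl k) (val i) \in orbit_seq O.
Proof.
have := valP i; rewrite !mem_orbit_seq => /eqP iO; rewrite -[X in _ == X]iO.
rewrite eqmodE; apply/same_orbitP; exists (simple_refl k)^-1%g.
by rewrite place_permM mulVg place_perm1.
Qed.

Definition swap O (k : 'I_n.-1) (i : in_orbit O) : in_orbit O :=
  SeqSub (swap_subproof k i).

End Orbits.

Inductive klr_gen (n : nat) (T : Type) : Type :=
  | PsiGen of 'I_n.-1 | YGen of 'I_n | EGen of T.
HB.instance Definition _ n T := gen_eqMixin (klr_gen n T).
HB.instance Definition _ n T := gen_choiceMixin (klr_gen n T).

Section KLR.
Variables (R : fieldType) (e : nat) (L : weight e) (n : nat).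

Section OrbitAlgebra.
Variable O : Orbit e n.

Local Notation gen := (klr_gen n (in_orbit O)).
Local Notation psi k := (fgen (PsiGen _ k) : free_alg R gen).
Local Notation y k := (fgen (YGen _ k) : free_alg R gen).
Local Notation idem i := (fgen (EGen n i) : free_alg R gen).

(* [arrow i j] and [arrow j i] exclude each other and [i = j] unless [e] is [1]
   or [2].
   A relation [lhs = rhs] is recorded as the relator [lhs - rhs]. *)
Inductive klr_relator : free_alg R gen -> Prop :=
| RelCyc (k : 'I_n) (i : in_orbit O) : k = 0%N :> nat ->
    klr_relator (y k ^+ L (val i k) * idem i)
| RelEE (i j : in_orbit O) :
    klr_relator (idem i * idem j - (if i == j then idem i else 0))
| RelE1 : klr_relator (\sum_(i : in_orbit O) idem i - 1)
| RelEY k (i : in_orbit O) : klr_relator (idem i * y k - y k * idem i)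
| RelPsiE k (i : in_orbit O) :
    klr_relator (psi k * idem i - idem (swap k i) * psi k)
| RelYY k l : klr_relator (y k * y l - y l * y k)
| RelPsiY (k : 'I_n.-1) (l : 'I_n) : l != lo k -> l != hi k ->
    klr_relator (psi k * y l - y l * psi k)
| RelPsiPsi (k l : 'I_n.-1) : l != k.+1 :> nat -> k != l.+1 :> nat ->
    klr_relator (psi k * psi l - psi l * psi k)
| RelPsiYhi k (i : in_orbit O) :
    klr_relator (psi k * y (hi k) * idem i
      - (y (lo k) * psi k + (val i (lo k) == val i (hi k))%:R) * idem i)
| RelYhiPsi k (i : in_orbit O) :
    klr_relator (y (hi k) * psi k * idem i
      - (psi k * y (lo k) + (val i (lo k) == val i (hi k))%:R) * idem i)
| RelPsi2_eq k (i : in_orbit O) : val i (lo k) = val i (hi k) ->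
    klr_relator (psi k ^+ 2 * idem i)
| RelPsi2_to k (i : in_orbit O) : arrow (val i (lo k)) (val i (hi k)) ->
    klr_relator (psi k ^+ 2 * idem i - (y (hi k) - y (lo k)) * idem i)
| RelPsi2_from k (i : in_orbit O) : arrow (val i (hi k)) (val i (lo k)) ->
    klr_relator (psi k ^+ 2 * idem i - (y (lo k) - y (hi k)) * idem i)
| RelPsi2_far k (i : in_orbit O) : val i (lo k) != val i (hi k) ->
    ~~ arrow (val i (lo k)) (val i (hi k)) ->
    ~~ arrow (val i (hi k)) (val i (lo k)) ->
    klr_relator (psi k ^+ 2 * idem i - idem i)
| RelBraid_to (k l : 'I_n.-1) (i : in_orbit O) : l = k.+1 :> nat ->
    val i (hi l) = val i (lo k) -> arrow (val i (lo k)) (val i (hi k)) ->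
    klr_relator ((psi k * psi l * psi k - psi l * psi k * psi l) * idem i
                 - idem i)
| RelBraid_from (k l : 'I_n.-1) (i : in_orbit O) : l = k.+1 :> nat ->
    val i (hi l) = val i (lo k) -> arrow (val i (hi k)) (val i (lo k)) ->
    klr_relator ((psi k * psi l * psi k - psi l * psi k * psi l) * idem i
                 + idem i)
| RelBraid_other (k l : 'I_n.-1) (i : in_orbit O) : l = k.+1 :> nat ->
    ~ (val i (hi l) = val i (lo k) /\
       (arrow (val i (lo k)) (val i (hi k)) \/
        arrow (val i (hi k)) (val i (lo k)))) ->
    klr_relator ((psi k * psi l * psi k - psi l * psi k * psi l) * idem i).

Definition klr_orbit : pzAlgType R := alg_quot klr_relator.

Definition psi_orbit k : klr_orbit := to_quot klr_relator (psi k).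
Definition y_orbit k : klr_orbit := to_quot klr_relator (y k).
Definition idem_orbit i : klr_orbit := to_quot klr_relator (idem i).

End OrbitAlgebra.

(* The direct sum over all orbits is formed as a direct product; all but
   finitely many factors are zero, see [klr_orbit_eq0] below. *)
Definition klr : pzAlgType R := dprod klr_orbit.

Definition psi k : klr := fun O => psi_orbit O k.
Definition y k : klr := fun O => y_orbit O k.
Definition idem (i : Iseq e n) : klr := fun O =>
  if insub i is Some i' then @idem_orbit O i' else 0.

End KLR.

Arguments klr_relator R {e} L {n} O _.

Section FiniteSupport.
Variables (R : fieldType) (e : nat) (L : weight e) (n : nat).

Section InOrbit.
Variable O : Orbit e n.
Implicit Types (i : in_orbit O).

Local Notation E i := (idem_orbit R L i).
Local Notation P k := (psi_orbit R L O k).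

Lemma klr_relP x y : klr_relator R L O (x - y) ->
  to_quot (klr_relator R L O) x = to_quot (klr_relator R L O) y.
Proof. by move=> r; apply/to_quotP/GenIdealIn. Qed.

Lemma psi_idem_orbit k i : P k * E i = E (swap k i) * P k.
Proof.
by rewrite /psi_orbit /idem_orbit -!rmorphM; apply/klr_relP/RelPsiE.
Qed.

Lemma psi2_idem_orbit k i : val i (lo k) != val i (hi k) ->
  ~~ arrow (val i (lo k)) (val i (hi k)) ->
  ~~ arrow (val i (hi k)) (val i (lo k)) -> P k ^+ 2 * E i = E i.
Proof.
move=> h1 h2 h3.
by rewrite /psi_orbit /idem_orbit -rmorphXn -rmorphM; apply/klr_relP/RelPsi2_far.
Qed.

Lemma sum_idem_orbit : \sum_(i : in_orbit O) E i = 1.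
Proof.
rewrite -(rmorph1 (to_quot (klr_relator R L O))) /idem_orbit -rmorph_sum.
exact/klr_relP/RelE1.
Qed.

Lemma idem_orbit_eq0 (k : 'I_n) i : L (val i k) = 0%N ->
  (forall m : 'I_n, (m < k)%N ->
     [&& val i m != val i k, ~~ arrow (val i m) (val i k)
       & ~~ arrow (val i k) (val i m)]) -> E i = 0.
Proof.
case: k => k; elim: k i => [|k IHk] i lt_kn Lik far.
  have : to_quot (klr_relator R L O)
      (fgen (YGen _ (Ordinal lt_kn)) ^+ L (val i (Ordinal lt_kn))
         * fgen (EGen n i)) = to_quot _ 0.
    by apply/to_quotP/GenIdealIn; rewrite subr0; apply: RelCyc.
  by rewrite Lik expr0 mul1r rmorph0.
have lt_kn1 : (k < n.-1)%N by rewrite -ltnS prednK // (leq_ltn_trans _ lt_kn).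
pose p : 'I_n.-1 := Ordinal lt_kn1.
have hip : hi p = Ordinal lt_kn by apply: val_inj.
have /and3P[h1 h2 h3] := far (lo p) (ltnSn k).
rewrite -(psi2_idem_orbit (k := p)) ?hip // expr2 -mulrA psi_idem_orbit.
have -> : E (swap p i) = 0; last by rewrite mul0r mulr0.
have swi (m : 'I_n) : val (swap p i) m = val i (simple_refl p m).
  by rewrite /= ffunE.
have swlo : simple_refl p (lo p) = Ordinal lt_kn by rewrite tpermL.
have lok lt_kn' : Ordinal (m := k) lt_kn' = lo p by apply: val_inj.
apply: (IHk _ (ltnW lt_kn)); first by rewrite swi lok swlo.
move=> m lt_mk; rewrite !swi lok swlo.
have -> : simple_refl p m = m.
  apply: tpermD; rewrite neq_ltn orbC; first by rewrite /= lt_mk.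
  by rewrite /= (ltn_trans lt_mk).
by apply: far; apply: (ltn_trans lt_mk).
Qed.

End InOrbit.

Lemma klr_orbit_eq0 (supp : seq (Zmod e)) :
  (forall a, L a != 0%N -> a \in supp) ->
  exists s : seq (Orbit e n),
    forall O, O \notin s -> (1 : klr_orbit R L O) = 0.
Proof.
move=> Lsupp.
pose B := [seq a + cls e (c%:Z - n%:Z) | a <- supp, c <- iota 0 n.*2.+1].
pose Bseq (f : {ffun 'I_n -> seq_sub B}) : Iseq e n := [ffun k => val (f k)].
exists [seq orbit_of (Bseq f) | f <- enum {: {ffun 'I_n -> seq_sub B}}] => O Os.
rewrite -sum_idem_orbit big1 // => i _.
apply: contraNeq Os => Ei.
have near (k : 'I_n) : exists2 a, a \in supp &
    exists2 c : int, (`|c| <= k)%N & val i k = a + cls e c.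
  case: k => k; elim/ltn_ind: k => k IHk lt_kn; set K := Ordinal lt_kn.
  have [Lk|/Lsupp ik] := eqVneq (L (val i K)) 0%N; last first.
    by exists (val i K) => //; exists 0 => //; rewrite raddf0 addr0.
  have /existsP[m] : [exists m : 'I_n, (m < k)%N && ~~ [&& val i m != val i K,
      ~~ arrow (val i m) (val i K) & ~~ arrow (val i K) (val i m)]].
    apply: contraNT Ei => /existsPn far; apply/eqP/(idem_orbit_eq0 Lk) => m lt_m.
    by have := far m; rewrite lt_m negbK.
  case/andP => lt_mk.
  have [a a_supp [c cm im]] := IHk m lt_mk (ltn_ord m).
  have {}im : val i m = a + cls e c by rewrite -im; congr (val i _); apply: val_inj.
  rewrite /= in cm.
  rewrite !negb_and !negbK => /or3P[/eqP ik|/eqP ik|/eqP ik]; exists a => //.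
  - by exists c; [exact: leq_trans cm (ltnW lt_mk)|rewrite -ik].
  - exists (c + 1); last by rewrite ik im raddfD addrA.
    by rewrite /=; move: cm lt_mk; clear; lia.
  - exists (c - 1); last first.
      by apply: (addIr (cls e 1)); rewrite -ik im -addrA -raddfD subrK.
    by rewrite /=; move: cm lt_mk; clear; lia.
have inB k : val i k \in B.
  have [a a_supp [c ck ->]] := near k.
  apply/allpairsP; exists (a, `|(c + n%:Z)%R|%N); rewrite mem_iota /=; split=> //.
    by have := ltn_ord k; move: ck; clear; lia.
  by congr (_ + cls e _); have := ltn_ord k; move: ck; clear; lia.
pose f : {ffun 'I_n -> seq_sub B} := [ffun k => SeqSub (inB k)].
apply/mapP; exists f; rewrite ?mem_enum //.
have := valP i; rewrite mem_orbit_seq => /eqP iO; rewrite -[LHS]iO.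
by congr orbit_of; apply/ffunP => k; rewrite !ffunE.
Qed.

End FiniteSupport.

Section TemperleyLieb.
Variables (R : fieldType) (e : nat) (L : weight e) (n : nat).

(* [k1], [k2], [k3] are the first three places, so [i k1] is [i_1], etc. *)
Inductive tl_relator : klr R L n -> Prop :=
| TLRel2 (i : Iseq e n) (k1 k2 : 'I_n) :
    k1 = 0%N :> nat -> k2 = 1%N :> nat ->
    (0 < L (i k1))%N -> i k2 = i k1 + cls e 1 -> tl_relator (idem R L i)
| TLRel3 (i : Iseq e n) (k1 k2 k3 : 'I_n) :
    k1 = 0%N :> nat -> k2 = 1%N :> nat -> k3 = 2%N :> nat ->
    i k1 != i k2 -> i k1 != i k3 -> i k2 != i k3 ->
    (0 < L (i k1))%N -> (0 < L (i k2))%N -> (0 < L (i k3))%N ->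
    tl_relator (idem R L i).

Definition TL : pzAlgType R := alg_quot tl_relator.

Definition tl_psi (k : 'I_n.-1) : TL := to_quot tl_relator (psi R L k).
Definition tl_idem (i : Iseq e n) : TL := to_quot tl_relator (idem R L i).

End TemperleyLieb.

(* A one-column [r]-partition of [n] is given by the lengths of its columns. *)
Record onecol (r n : nat) := OneCol {
  col :> {ffun 'I_r -> nat};
  col_sum : \sum_(l < r) col l = n
}.

(* The node [(a, 1, l)] of a one-column [r]-partition of [n] is [(a - 1, l)]. *)
Definition node (r n : nat) : Type := 'I_n * 'I_r.

(* The order on [nat * 'I_r]; rows count from [0]. *)
Definition node_lt r (g h : nat * 'I_r) : bool :=
  (g.1 < h.1)%N || (g.1 == h.1) && (g.2 < h.2)%N.
Definition node_le r (g h : nat * 'I_r) : bool := (g == h) || node_lt g h.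

Definition node_val r n (g : node r n) : nat * 'I_r := (g.1 : nat, g.2).

Section Tableaux.
Variables r n : nat.
Implicit Types lam mu nu : onecol r n.

Notation node := (node r n).
Notation node_val := (@node_val r n).

Definition in_D lam : bool := (3 <= #|[pred l | (0 < lam l)%N]|)%N.

Definition nodes lam : {set node} := [set g : node | (g.1 < lam g.2)%N]%SET.

Definition dom_le lam mu : Prop := forall g0 : nat * 'I_r,
  (#|[pred g in nodes mu | node_le (node_val g) g0]|
     <= #|[pred g in nodes lam | node_le (node_val g) g0]|)%N.
Definition dom_lt lam mu : Prop := dom_le lam mu /\ lam <> mu.

(* [k : 'I_n] stands for the number [k + 1]. *)
Definition is_tableau lam (t : {ffun 'I_n -> node}) : bool :=
  injectiveb t && ([set t k | k : 'I_n]%SET == nodes lam).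

Definition is_standard lam (t : {ffun 'I_n -> node}) : bool :=
  is_tableau lam t &&
  [forall k : 'I_n, forall k' : 'I_n, ((t k).2 == (t k').2) && ((t k).1 < (t k').1)%N
                          ==> (k < k')%N].

Definition Std lam : Type := {t : {ffun 'I_n -> node} | is_standard lam t}.
HB.instance Definition _ lam := Finite.on (Std lam).
HB.instance Definition _ lam := SubType.on (Std lam).

Definition is_initial lam (t : {ffun 'I_n -> node}) : bool :=
  is_tableau lam t &&
  [forall k : 'I_n, forall k' : 'I_n, (k < k')%N ==>
     node_lt (node_val (t k)) (node_val (t k'))].

Lemma node_le_total : total (relpre node_val (@node_le r)).
Proof.
move=> [a l] [b m]; rewrite /= /node_le /node_lt /= !xpair_eqE -!val_eqE /=.
by clear; lia.
Qed.

Lemma node_le_trans : transitive (relpre node_val (@node_le r)).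
Proof.
move=> [a l] [b m] [c p].
rewrite /= /node_le /node_lt /= !xpair_eqE -!val_eqE /=.
by clear; lia.
Qed.

Lemma card_nodes lam : #|nodes lam| = n.
Proof.
rewrite -[RHS](col_sum lam) -sum1_card.
under eq_bigl do rewrite inE.
rewrite (reindex (fun x : 'I_r * 'I_n => (x.2, x.1))) /=; last first.
  by exists (fun x : node => (x.2, x.1)) => -[].
rewrite -(pair_big_dep xpredT (fun l (a : 'I_n) => (a < lam l)%N) (fun _ _ => 1%N)).
apply: eq_bigr => l _ /=.
have le_n : (lam l <= n)%N by rewrite -{2}(col_sum lam) (bigD1 l) //= leq_addr.
by rewrite -(big_ord_widen _ (fun _ => 1%N) le_n) sum_nat_const card_ord muln1.
Qed.

Lemma initial_exists lam : exists t, is_initial lam t.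
Proof.
pose le := relpre node_val (@node_le r).
pose s := sort le (enum (nodes lam)).
have s_n : size s == n by rewrite size_sort -cardE card_nodes.
have s_uniq : uniq s by rewrite sort_uniq enum_uniq.
have s_sorted : sorted le s := sort_sorted node_le_total _.
have s_mem x : (x \in s) = (x \in nodes lam) by rewrite mem_sort mem_enum.
pose t : {ffun 'I_n -> node} := [ffun k => tnth (Tuple s_n) k].
have t_inj : injective t.
  by move=> k k'; rewrite !ffunE; apply/tuple_uniqP.
exists t; apply/andP; split.
  apply/andP; split; first exact/injectiveP.
  apply/eqP/setP => x; rewrite -s_mem.
  apply/imsetP/idP => [[k _ ->]|]; first by rewrite ffunE mem_tnth.
  case/(nthP x) => k; rewrite (eqP s_n) => lt_k <-.
  by exists (Ordinal lt_k); rewrite ?ffunE ?(tnth_nth x).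
apply/forallP => k; apply/forallP => k'; apply/implyP => lt_k.
have : le (t k) (t k').
  rewrite !ffunE !(tnth_nth (t k)) /=.
  apply: (sorted_leq_nth node_le_trans) => //; rewrite ?inE ?(eqP s_n) //.
  - by move=> x; rewrite /= /node_le eqxx.
  - exact: ltnW.
case/orP => // /eqP t_eq; suff /t_inj kk : t k = t k' by rewrite kk ltnn in lt_k.
by case: (t k) (t k') t_eq => [a l] [b m] [/val_inj -> ->].
Qed.

(* [t^lam] *)
Definition tinit lam : {ffun 'I_n -> node} := xchoose (initial_exists lam).

(* [d(t)] *)
Definition dperm lam (t : Std lam) : 'S_n :=
  odflt 1%g [pick d : 'S_n | val t == [ffun k => tinit lam (d k)]].

(* [s_(i_1) ... s_(i_k)] with composition of functions from right to left;
   products in ['S_n] compose from left to right, hence [rev]. *)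
Definition word_perm (w : seq 'I_n.-1) : 'S_n :=
  (\prod_(k <- rev w) simple_refl k)%g.

Definition reduced (w : seq 'I_n.-1) : Prop :=
  forall w', word_perm w' = word_perm w -> (size w <= size w')%N.

Definition word_family : Type := forall lam, Std lam -> seq 'I_n.-1.

Definition official (w : word_family) : Prop :=
  forall lam, ~~ in_D lam -> forall t : Std lam,
    [/\ word_perm (w lam t) = dperm t, reduced (w lam t) &
        forall w' k, w lam t = rcons w' k -> exists s : Std lam, w lam s = w'].

End Tableaux.

Section Modules.
Variable A : pzRingType.
Implicit Types M L : lmodType A.

Section CompositionSeries.
Variables (M : lmodType A).
Definition simple_factor (N N' : {pred M}) : Prop :=
  [/\ {subset N <= N'}, ~ (N =i N') &
      forall P : {pred M}, GRing.submod_closed P ->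
        {subset N <= P} -> {subset P <= N'} -> P =i N \/ P =i N'].

Definition factor_iso (N N' : {pred M}) (L : lmodType A) : Prop :=
  exists f : M -> L,
    [/\ forall a, {in N' &, forall x z, f (a *: x + z) = a *: f x + f z},
        forall v, exists2 x, x \in N' & f x = v &
        {in N', forall x, f x = 0 <-> x \in N}].

Definition composition_series (k : nat) (N : nat -> {pred M}) : Prop :=
  [/\ N 0%N =i pred1 0, N k =i predT,
      forall i, (i <= k)%N -> GRing.submod_closed (N i) &
      forall i, (i < k)%N -> simple_factor (N i) (N i.+1)].

End CompositionSeries.

(* [[M : L]], which does not depend on the series by the Jordan-Hoelder
   theorem; it is [0] if [M] has no composition series. *)
Definition comp_mult M L : nat :=
  xget 0%N [set m | exists k (N : nat -> {pred M}), composition_series k N /\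
    m = \sum_(i < k) (`[< factor_iso (N i) (N i.+1) L >] : nat)]%classic.

End Modules.

Section Cells.
Variables (R : fieldType) (e r n : nat) (j : 'I_r -> Zmod e).
Variable w : word_family r n.

Local Notation A := (TL R (sum_fund_weights j) n).
Implicit Types lam mu nu : onecol r n.

(* Rows count from [0], so [1 - a + j_l] becomes [j_l - a]. *)
Definition residue (g : node r n) : Zmod e := j g.2 - cls e (g.1 : nat)%:Z.

Definition idem_of lam : A :=
  tl_idem R (sum_fund_weights j) [ffun k => residue (tinit lam k)].

Definition psi_word (s : seq 'I_n.-1) : A :=
  \prod_(k <- s) tl_psi R (sum_fund_weights j) k.

(* [C^lam_(s,t)]; the anti-automorphism [*] fixes the generators, so it maps
   the product along a word to the product along the reversed word, see
   [anti_psi_word]. *)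
Definition cell_elt lam (s t : Std lam) : A :=
  psi_word (rev (w s)) * idem_of lam * psi_word (w t).

Lemma anti_psi_word (star : A -> A) : star 1 = 1 ->
  (forall a b, star (a * b) = star b * star a) ->
  (forall k, star (tl_psi R (sum_fund_weights j) k) = tl_psi R _ k) ->
  forall s, star (psi_word s) = psi_word (rev s).
Proof.
move=> star1 starM star_psi; elim=> [|k s IHs]; first by rewrite /psi_word big_nil.
rewrite /psi_word big_cons starM star_psi -/(psi_word s) IHs.
by rewrite rev_cons -cats1 big_cat big_seq1.
Qed.

Definition lower_span lam (z : A) : Prop :=
  exists m (c : 'I_m -> R) (u : 'I_m -> A),
    (forall i, exists nu (x y : Std nu),
       [/\ ~~ in_D nu, dom_lt nu lam & u i = cell_elt x y]) /\
    z = \sum_i scal (c i) * u i.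

Definition cell_congr lam (x y : A) : Prop := lower_span lam (x - y).

(* [W] is the cell module of [lam], with [C s] as [C_s]: the [C s] form a basis
   over [R], and [rho s' s] is the coefficient [r_a(s',s)] determined by the
   action of [a] on the cellular basis modulo lower terms. *)
Definition is_cell_module lam (W : lmodType A) (C : Std lam -> W) : Prop :=
  (forall v : W, exists! c : {ffun Std lam -> R},
     v = \sum_s (scal (c s) : A) *: C s) /\
  forall (a : A) (rho : Std lam -> Std lam -> R),
    (forall s, a *: C s = \sum_s' (scal (rho s' s) : A) *: C s') <->
    (forall s t, cell_congr lam (a * cell_elt s t)
                   (\sum_s' scal (rho s' s) * cell_elt s' t)).

Definition is_cell_form lam (W : lmodType A) (C : Std lam -> W)
    (phi : W -> W -> R) : Prop :=
  [/\ forall (c : R) u v x,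
        phi ((scal c : A) *: u + v) x = c * phi u x + phi v x,
      forall (c : R) u v x,
        phi x ((scal c : A) *: u + v) = c * phi x u + phi x v &
      forall s t (c : R), phi (C t) (C s) = c <->
        forall s' t', cell_congr lam (cell_elt s' t * cell_elt s t')
                        (scal c * cell_elt s' t')].

(* [L = W / rad(phi_lam)], with [p] the canonical projection *)
Definition is_cell_head lam (W : lmodType A) (C : Std lam -> W)
    (L : lmodType A) : Prop :=
  exists (phi : W -> W -> R) (p : {linear W -> L}),
    [/\ is_cell_form C phi, forall v, exists u, p u = v &
        forall u, p u = 0 <-> forall v, phi u v = 0].

End Cells.

Definition pair_ord (T : Type) (a b : T) (k : 'I_2) : T :=
  if k == ord0 then a else b.

(* Main.v *)
(* The cyclotomic relations and the Temperley-Lieb relators for Lambda hold in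
   TLB_n^{Lambda'}: an idempotent e(i) dies there as soon as some residue i_k
   outside {j_u, j_v} is neither equal nor adjacent to the preceding ones, since
   it can then be moved to the front. This gives a surjection
   pi : TL_{r,1,n}^Lambda -> TLB_n^{Lambda'}. It kills C^nu_{s,t} when nu has a
   non-empty component other than the u-th and the v-th, and sends it to
   C^{nu'}_{s,t} otherwise; the chosen reduced words of d(t) do not matter, because
   d(t) is a union of two increasing sequences, hence 321-avoiding, and the reduced
   words of such a permutation differ by commutations only. So pi carries the
   congruences defining W(lambda) and phi_mu to those for lambda' and mu', i.e.
   W(lambda) and L(mu) are the inflations of W(lambda') and L(mu') along pi, and
   inflation along a surjection preserves composition multiplicities. *)
Require Import Defs.
From HB Require Import structures.
From mathcomp Require Import all_boot all_order all_fingroup all_algebra.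
From mathcomp Require Import zify boolp.

Set Implicit Arguments.
Unset Strict Implicit.
Unset Printing Implicit Defensive.

Import GRing.Theory.
Local Open Scope ring_scope.

(** * Restriction of the weight *)

Section QuotientMap.
Variables (R : pzRingType) (A B : pzAlgType R).
Variables (S : A -> Prop) (T : B -> Prop) (f : {rmorphism A -> B}).
Hypothesis fS : forall x, S x -> gen_ideal T (f x).

(** Evaluated on a chosen representative; independence of the choice is [quot_mapE]. *)
Definition quot_map (x : alg_quot S) : alg_quot T := to_quot T (f (of_quot x)).

Lemma gen_ideal_map x : gen_ideal S x -> gen_ideal T (f x).
Proof.
elim=> {x} [x /fS//||x y _ Ix _ Iy|a x _ Ix|x a _ Ix].
- by rewrite rmorph0; apply: GenIdeal0.
- by rewrite rmorphB; apply: GenIdealB.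
- by rewrite rmorphM; apply: GenIdealMl.
- by rewrite rmorphM; apply: GenIdealMr.
Qed.

Lemma quot_mapE x : quot_map (to_quot S x) = to_quot T (f x).
Proof.
by apply/to_quotP; rewrite -rmorphB; apply/gen_ideal_map/of_quot_ideal.
Qed.

Lemma quot_map_zmod : zmod_morphism quot_map.
Proof.
move=> x y; rewrite -(of_quotK x) -(of_quotK y) -raddfB !quot_mapE.
by rewrite -raddfB -rmorphB.
Qed.

Lemma quot_map_monoid : monoid_morphism quot_map.
Proof.
split=> [|x y].
  by rewrite -(rmorph1 (to_quot S)) quot_mapE !rmorph1.
by rewrite -(of_quotK x) -(of_quotK y) -rmorphM !quot_mapE -!rmorphM.
Qed.

Lemma quot_map_scal : (forall c, f (scal c) = scal c) ->
  forall c, quot_map (scal c) = scal c.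
Proof. by move=> fc c; rewrite [LHS]quot_mapE fc. Qed.

Lemma quot_map_surj : (forall y, exists x, f x = y) ->
  forall y, exists x, quot_map x = y.
Proof.
move=> f_surj y; have [x fx] := f_surj (of_quot y).
by exists (to_quot S x); rewrite quot_mapE fx of_quotK.
Qed.

End QuotientMap.

Lemma to_quot_comm (R : pzRingType) (A : pzAlgType R) (S : A -> Prop) (x y : A) :
  x * y = y * x -> to_quot S x * to_quot S y = to_quot S y * to_quot S x.
Proof. by move=> xy; rewrite -rmorphM xy rmorphM. Qed.

Section WeightRestriction.
Variables (R : fieldType) (e n : nat) (L L' : weight e).
Hypothesis leL : forall a, (L' a <= L a)%N.

Definition klr_map (x : klr R L n) : klr R L' n :=
  fun O => quot_map (klr_relator R L' O) idfun (x O).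

(** Only the cyclotomic relator depends on the weight. Since [L'] is at most [L], the one for [L] is
    a left multiple, by a power of [y k], of the one for [L']; every other relator is literally the
    same. *)
Lemma klr_relator_le (O : Orbit e n) (x : free_alg R (klr_gen n (Defs.in_orbit O))) :
  klr_relator R L O x -> gen_ideal (klr_relator R L' O) x.
Proof.
case.
- move=> k i k0; rewrite -(subnK (leL (val i k))) exprD -mulrA.
  exact/GenIdealMl/GenIdealIn/RelCyc.
- by move=> i i'; apply/GenIdealIn/RelEE.
- exact/GenIdealIn/RelE1.
- by move=> k i; apply/GenIdealIn/RelEY.
- by move=> k i; apply/GenIdealIn/RelPsiE.
- by move=> k l; apply/GenIdealIn/RelYY.
- by move=> k l lk hk; apply/GenIdealIn/RelPsiY.
- by move=> k l kl lk; apply/GenIdealIn/RelPsiPsi.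
- by move=> k i; apply/GenIdealIn/RelPsiYhi.
- by move=> k i; apply/GenIdealIn/RelYhiPsi.
- by move=> k i ik; apply/GenIdealIn/RelPsi2_eq.
- by move=> k i ik; apply/GenIdealIn/RelPsi2_to.
- by move=> k i ik; apply/GenIdealIn/RelPsi2_from.
- by move=> k i ik ik' ik''; apply/GenIdealIn/RelPsi2_far.
- by move=> k l i kl il ik; apply/GenIdealIn/RelBraid_to.
- by move=> k l i kl il ik; apply/GenIdealIn/RelBraid_from.
- by move=> k l i kl il; apply/GenIdealIn/RelBraid_other.
Qed.

Lemma klr_mapE (O : Orbit e n) (x : free_alg R (klr_gen n (Defs.in_orbit O))) :
  quot_map (klr_relator R L' O) idfun (to_quot (klr_relator R L O) x)
  = to_quot (klr_relator R L' O) x.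
Proof. by rewrite quot_mapE // => z; apply: klr_relator_le. Qed.

Lemma klr_map_zmod : zmod_morphism klr_map.
Proof.
move=> x y; apply/functional_extensionality_dep => O; apply: quot_map_zmod.
exact: klr_relator_le.
Qed.

Lemma klr_map_monoid : monoid_morphism klr_map.
Proof.
split=> [|x y]; apply/functional_extensionality_dep => O.
  by apply: (quot_map_monoid _).1; apply: klr_relator_le.
by apply: (quot_map_monoid _).2; apply: klr_relator_le.
Qed.

HB.instance Definition _ :=
  GRing.isZmodMorphism.Build (klr R L n) (klr R L' n) klr_map klr_map_zmod.
HB.instance Definition _ :=
  GRing.isMonoidMorphism.Build (klr R L n) (klr R L' n) klr_map klr_map_monoid.

Lemma klr_map_scal c : klr_map (scal c) = scal c.
Proof.
apply/functional_extensionality_dep => O; rewrite /klr_map quot_map_scal //.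
exact: klr_relator_le.
Qed.

Lemma klr_map_surj (y : klr R L' n) : exists x, klr_map x = y.
Proof.
exists (fun O => to_quot (klr_relator R L O) (of_quot (y O))).
by apply/functional_extensionality_dep => O; rewrite /klr_map klr_mapE of_quotK.
Qed.

Lemma klr_map_psi k : klr_map (psi R L k) = psi R L' k.
Proof. by apply/functional_extensionality_dep => O; apply: klr_mapE. Qed.

Lemma klr_map_idem i : klr_map (idem R L i) = idem R L' i.
Proof.
apply/functional_extensionality_dep => O; rewrite /klr_map /idem.
case: insubP => [i' _ _|_]; first exact: klr_mapE.
by rewrite -(raddf0 (to_quot _)) klr_mapE raddf0.
Qed.

(** Collects everything about the map that cell elements involve: scalars, the [psi k] and the
    idempotents. The morphism structure is packed inside the proof because it depends on the
    assumption on the relators. *)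
Lemma tl_map_exists :
    (forall x : klr R L n, tl_relator x ->
       gen_ideal (@tl_relator R e L' n) (klr_map x)) ->
  exists pi : {rmorphism TL R L n -> TL R L' n},
    [/\ forall b, exists a, pi a = b,
        forall c, pi (scal c) = scal c,
        forall k, pi (tl_psi R L k) = tl_psi R L' k &
        forall i, pi (tl_idem R L i) = tl_idem R L' i].
Proof.
move=> tlL; pose g := quot_map (S := @tl_relator R e L n) (@tl_relator R e L' n) klr_map.
pose gZ := GRing.isZmodMorphism.Build _ _ g (quot_map_zmod tlL).
pose gM := GRing.isMonoidMorphism.Build _ _ g (quot_map_monoid tlL).
pose pi : {rmorphism TL R L n -> TL R L' n} := HB.pack g gZ gM.
exists pi; split=> /=.
- exact/quot_map_surj/klr_map_surj.
- exact/quot_map_scal/klr_map_scal.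
- by move=> k; rewrite [LHS]quot_mapE // /tl_psi -klr_map_psi.
- by move=> i; rewrite [LHS]quot_mapE // /tl_idem -klr_map_idem.
Qed.

End WeightRestriction.

Section Idempotents.
Variables (R : fieldType) (e n : nat) (L : weight e).

(** Componentwise form of [idem_orbit_eq0]: [psi^2 e(i) = e(i)] for far residues lets the entry at
    place [k] move to the front, where the cyclotomic relation with exponent 0 kills the
    idempotent. *)
Lemma idem_eq0 (i : Iseq e n) (k : 'I_n) : L (i k) = 0%N ->
  (forall m : 'I_n, (m < k)%N ->
     [&& i m != i k, ~~ arrow (i m) (i k) & ~~ arrow (i k) (i m)]) ->
  idem R L i = 0.
Proof.
move=> Lk far; apply/functional_extensionality_dep => O; rewrite /idem.
by case: insubP => [i' _ vi'|//]; apply: (@idem_orbit_eq0 _ _ _ _ _ k);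
  rewrite vi'.
Qed.

Lemma tl_psiC (k l : 'I_n.-1) : l != k.+1 :> nat -> k != l.+1 :> nat ->
  tl_psi R L k * tl_psi R L l = tl_psi R L l * tl_psi R L k.
Proof.
move=> kl lk.
have psiC : psi R L k * psi R L l = psi R L l * psi R L k.
  apply/functional_extensionality_dep => O.
  change (psi_orbit R L O k * psi_orbit R L O l
          = psi_orbit R L O l * psi_orbit R L O k).
  by rewrite /psi_orbit -!rmorphM; apply/klr_relP/RelPsiPsi.
exact: (to_quot_comm (@tl_relator R e L n) psiC).
Qed.

End Idempotents.

(** * Relators for weights whose fundamental constituents are far apart *)

Section FarWeights.
Variables (R : fieldType) (e n r : nat) (j : 'I_r -> Zmod e) (u v : 'I_r).
Hypothesis j_far : forall a b, a != b -> (2 < Idist (j a) (j b))%N.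
Hypothesis neq_uv : u != v.

Local Notation L := (sum_fund_weights j).
Local Notation L' := (sum_fund_weights (pair_ord (j u) (j v))).

(** Used with [c = 0] and [c = 1]: residues at distance above 2 are neither equal nor joined by an
    arrow. *)
Lemma Idist_le (a : Zmod e) (c : int) : (Idist a (a + cls e c)%R <= `|c|)%N.
Proof.
rewrite /Idist; case: ex_minnP => m _; apply; apply/asboolP.
have [d <-] := cls_surj a; exists d, (d + c); split=> //; first by rewrite raddfD.
by rewrite opprD addrA subrr sub0r abszN.
Qed.

Lemma j_neq a b : a != b -> j a != j b.
Proof.
move=> /j_far; apply: contraTneq => ->.
by rewrite -leqNgt -[X in Idist _ X]addr0 -(raddf0 (cls e)) (leq_trans (Idist_le _ _)).
Qed.

Lemma j_narrow a b : a != b -> ~~ arrow (j a) (j b).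
Proof.
move=> /j_far; apply: contraTN => /eqP ->.
by rewrite -leqNgt (leq_trans (Idist_le _ _)).
Qed.

Lemma j_apart a b : a != b ->
  [&& j a != j b, ~~ arrow (j a) (j b) & ~~ arrow (j b) (j a)].
Proof. by move=> ab; rewrite j_neq ?j_narrow // eq_sym. Qed.

Lemma sum_fund_weights_gt0 m (h : 'I_m -> Zmod e) (a : Zmod e) :
  (0 < sum_fund_weights h a)%N = [exists l, h l == a].
Proof.
rewrite lt0n sum_nat_eq0 negb_forall; apply: eq_existsb => l.
by rewrite /fund_weight; case: (h l == a).
Qed.

Lemma pair_weight_gt0 a : (0 < L' (j a))%N = (a == u) || (a == v).
Proof.
rewrite sum_fund_weights_gt0; apply/existsP/orP => [[l]|].
  rewrite /pair_ord; case: ifP => _ lj; [left|right];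
    by apply: contraTT lj => /j_neq; rewrite eq_sym.
by case=> /eqP ->; [exists ord0 | exists (lift ord0 ord0)]; rewrite /pair_ord.
Qed.

Lemma pair_weight_le a : (L' a <= L a)%N.
Proof.
rewrite /sum_fund_weights big_ord_recl big_ord1 /pair_ord /=.
by rewrite (bigD1 u) // (bigD1 v) ?(eq_sym v) //= [leqRHS]addnA leq_addr.
Qed.

(** The residue [j l] has [L']-weight 0 and is neither equal nor adjacent to the other [j a], so
    [idem_eq0] applies. This kills both the three-residue relators and the idempotents of shapes
    with nodes outside the components [u] and [v]. *)
Lemma tl_idem_far (i : Iseq e n) (k : 'I_n) (l : 'I_r) :
  i k = j l -> l != u -> l != v ->
  (forall m : 'I_n, (m < k)%N -> exists2 a, a != l & i m = j a) ->
  idem R L' i = 0.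
Proof.
move=> ik lu lv far; apply: (@idem_eq0 _ _ _ _ _ k).
  by apply/eqP; rewrite eqn0Ngt ik pair_weight_gt0 negb_or lu.
by move=> m /far[a al ->]; rewrite ik j_apart.
Qed.

(** A two-residue relator is again a relator for [L'], unless its first residue has [L']-weight 0,
    and then it vanishes. In a three-residue relator the residues are three distinct [j l], so some
    [l] differs from [u] and [v]; the first such place satisfies [tl_idem_far]. *)
Lemma tl_relator_pair (x : klr R L n) :
  tl_relator x -> gen_ideal (@tl_relator R e L' n) (klr_map L' x).
Proof.
have gt0P a : (0 < L a)%N -> exists l, a = j l.
  by rewrite sum_fund_weights_gt0 => /existsP[l /eqP <-]; exists l.
case=> [i k1 k2 k1_0 k2_1 Lk1 ik2|
        i k1 k2 k3 k1_0 k2_1 k3_2 n12 n13 n23 Lk1 Lk2 Lk3];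
  rewrite (klr_map_idem R pair_weight_le).
  have [L'k1|L'k1] := posnP (L' (i k1)); last first.
    exact/GenIdealIn/(TLRel2 R k1_0 k2_1).
  rewrite (@idem_eq0 _ _ _ _ _ k1) //; first exact: GenIdeal0.
  by move=> m; rewrite k1_0.
have [l1 i1] := gt0P _ Lk1; have [l2 i2] := gt0P _ Lk2.
have [l3 i3] := gt0P _ Lk3.
have nj (a b : 'I_r) : j a != j b -> a != b by apply: contraNneq => ->.
have {}n12 : l1 != l2 by apply: nj; rewrite -i1 -i2.
have {}n13 : l1 != l3 by apply: nj; rewrite -i1 -i3.
have {}n23 : l2 != l3 by apply: nj; rewrite -i2 -i3.
suff -> : idem R L' i = 0 by apply: GenIdeal0.
have [/norP[u1 v1]|l1uv] := boolP (~~ ((l1 == u) || (l1 == v))).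
  by apply: (tl_idem_far i1 u1 v1) => m; rewrite k1_0.
have lt1 m : (m < 1)%N -> m = k1 by rewrite k1_0; case: m.
have [/norP[u2 v2]|l2uv] := boolP (~~ ((l2 == u) || (l2 == v))).
  apply: (tl_idem_far i2 u2 v2) => m; rewrite k2_1 => m1; exists l1 => //.
  by rewrite -i1; congr (i _); apply: val_inj; apply: lt1.
(* Here [l1] and [l2] are distinct and both in [{u, v}], so they exhaust it. *)
have u3 : l3 != u /\ l3 != v.
  move: l1uv l2uv n12 n13 n23; rewrite !negbK.
  by do 2 case/orP => /eqP ->; rewrite ?eqxx // => _;
    rewrite !(eq_sym l3) => -> ->.
apply: (tl_idem_far i3 u3.1 u3.2) => m; rewrite k3_2 ltnS leq_eqVlt.
case/orP => [/eqP m1|m1].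
  by exists l2 => //; rewrite -i2; congr (i _); apply: val_inj; rewrite /= k2_1.
by exists l1 => //; rewrite -i1; congr (i _); apply: val_inj; apply: lt1.
Qed.

Lemma tl_restriction :
  exists pi : {rmorphism TL R L n -> TL R L' n},
    [/\ forall b, exists a, pi a = b,
        forall c, pi (scal c) = scal c,
        forall k, pi (tl_psi R L k) = tl_psi R L' k &
        forall i, pi (tl_idem R L i) = tl_idem R L' i].
Proof. exact/(tl_map_exists pair_weight_le)/tl_relator_pair. Qed.

End FarWeights.

(** * Reduced words of 321-avoiding permutations *)

Section ReducedWords.
Variable n : nat.
Implicit Types (d : 'S_n) (k l : 'I_n.-1) (x z : seq 'I_n.-1).

Local Notation refl := (@simple_refl n).

Definition inversions d : {set 'I_n * 'I_n} :=
  [set p : 'I_n * 'I_n | (p.1 < p.2)%N && (d p.2 < d p.1)%N]%SET.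

Definition avoids321 d : Prop := forall a b c : 'I_n,
  (a < b)%N -> (b < c)%N -> (d c < d b)%N -> (d b < d a)%N -> False.

Lemma lo_hi k : (lo k < hi k)%N.
Proof. exact: ltnSn. Qed.

Lemma reflK k (a : 'I_n) : refl k (refl k a) = a.
Proof. exact: tpermK. Qed.

Lemma mul_reflK k d : (refl k * (refl k * d))%g = d.
Proof. by rewrite mulgA tperm2 mul1g. Qed.

Lemma refl_lt k (a b : 'I_n) : (a < b)%N -> (a, b) != (lo k, hi k) ->
  (refl k a < refl k b)%N.
Proof.
rewrite xpair_eqE /simple_refl => ab.
case: tpermP => [a_lo|a_hi|/eqP na_lo /eqP na_hi];
  case: tpermP => [b_lo|b_hi|/eqP nb_lo /eqP nb_hi];
  move: ab; rewrite ?a_lo ?a_hi ?b_lo ?b_hi ?eqxx -?val_eqE //=;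
  try move: na_lo na_hi; try move: nb_lo nb_hi; rewrite -?val_eqE /=; lia.
Qed.

(** Entrywise application of [refl k] preserves the order of every pair other than [(lo k, hi k)],
    so it matches the remaining inversions of [refl k * d] with those of [d]. *)
Lemma inversions_refl k d :
  (#|inversions (refl k * d)%g :\ (lo k, hi k)|
     <= #|inversions d :\ (lo k, hi k)|)%N.
Proof.
pose f (p : 'I_n * 'I_n) := (refl k p.1, refl k p.2).
apply: leq_trans (leq_imset_card f _); apply/subset_leq_card/subsetP => -[a b].
rewrite !inE /= !permM => /and3P[nab lt_ab inv_ab].
apply/imsetP; exists (f (a, b)); last by rewrite /f /= !reflK.
rewrite !inE /= inv_ab refl_lt // !andbT /f xpair_eqE /=.
apply: contraTN lt_ab => /andP[/eqP ra /eqP rb].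
rewrite -(reflK k a) -(reflK k b) ra rb tpermL tpermR -leqNgt.
exact/ltnW/lo_hi.
Qed.

Lemma inversions_descent k d : (d (hi k) < d (lo k))%N ->
  (#|inversions (refl k * d)%g| < #|inversions d|)%N.
Proof.
move=> dk; have := inversions_refl k d.
rewrite (cardsD1 (lo k, hi k) (inversions d)).
rewrite (cardsD1 (lo k, hi k) (inversions (refl k * d))).
rewrite !inE lo_hi /= dk !permM tpermL tpermR [(d (lo k) < _)%N]ltnNge.
by rewrite (ltnW dk) add0n add1n ltnS.
Qed.

(** The last letter acts first, on positions. Hence the letters that can end a reduced word are the
    descents [d (hi k) < d (lo k)]. *)
Lemma word_perm_rcons x k : word_perm (rcons x k) = (refl k * word_perm x)%g.
Proof. by rewrite /word_perm rev_rcons big_cons. Qed.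

(** Each letter creates at most one inversion, namely at [(lo k, hi k)]. *)
Lemma inversions_word x : (#|inversions (word_perm x)| <= size x)%N.
Proof.
elim/last_ind: x => [|x k IHx].
  rewrite /word_perm big_nil /= leqn0 cards_eq0; apply/eqP/setP => p.
  by rewrite !inE !perm1; case: ltngtP.
rewrite word_perm_rcons size_rcons (cardsD1 (lo k, hi k)).
apply: leq_trans (leq_add (leq_b1 _) (inversions_refl k _)) _.
rewrite add1n ltnS (leq_trans _ IHx) //.
exact/subset_leq_card/subsetDl.
Qed.

(** Such a [d] is strictly increasing. Induction from the bottom gives [a <= d a], and induction on
    the distance to the top [n.-1] gives [d a <= a]. *)
Lemma no_descent_id d : (forall k, (d (lo k) < d (hi k))%N) -> d = 1%g.
Proof.
move=> inc.
have step (a b : 'I_n) : b = a.+1 :> nat -> (d a < d b)%N.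
  move=> ab; have lt_a : (a < n.-1)%N by have := ltn_ord b; lia.
  have -> : a = lo (Ordinal lt_a) by apply: val_inj.
  by have -> : b = hi (Ordinal lt_a) by apply: val_inj.
have ge_id m : forall a : 'I_n, a = m :> nat -> (a <= d a)%N.
  elim: m => [|m IHm] a am; first by rewrite am.
  have lt_m : (m < n)%N by have := ltn_ord a; lia.
  have := IHm (Ordinal lt_m) erefl; have := step (Ordinal lt_m) a am.
  by rewrite /=; lia.
have le_id m : forall a : 'I_n, (a + m)%N = n.-1 -> (d a <= a)%N.
  elim: m => [|m IHm] a am; first by have := ltn_ord (d a); lia.
  have lt_a : (a.+1 < n)%N by have := ltn_ord a; lia.
  have := IHm (Ordinal lt_a); have := step a (Ordinal lt_a) erefl.
  by rewrite /=; lia.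
apply/permP => a; rewrite perm1; apply/val_inj/eqP.
rewrite eqn_leq (ge_id a) // andbT (le_id (n.-1 - a)%N) //.
by rewrite subnKC //; have := ltn_ord a; lia.
Qed.

(** Sorting by adjacent transpositions: removing a descent lowers the number of inversions, and
    [inversions_word] shows that it drops by exactly one. *)
Lemma word_exists d : exists2 x, word_perm x = d & size x = #|inversions d|.
Proof.
have [m] := ubnP #|inversions d|; elim: m d => // m IHm d lt_dm.
have [/existsP[k dk]|/existsPn inc] := boolP [exists k, (d (hi k) < d (lo k))%N].
  have lt_k := inversions_descent dk.
  have [|x xd sx] := IHm (refl k * d)%g; first by apply: leq_trans lt_k _.
  exists (rcons x k); first by rewrite word_perm_rcons xd mul_reflK.
  apply/eqP; rewrite eqn_leq size_rcons sx lt_k /=.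
  have := inversions_word (rcons x k).
  by rewrite word_perm_rcons xd mul_reflK size_rcons sx.
have -> : d = 1%g.
  apply: no_descent_id => k; rewrite ltn_neqAle leqNgt inc andbT.
  by rewrite val_eqE (inj_eq perm_inj) -val_eqE /= neq_ltn ltnSn.
by exists [::]; rewrite /word_perm ?big_nil //; have := inversions_word [::];
  rewrite /word_perm big_nil leqn0 => /eqP ->.
Qed.

Lemma reduced_size x : reduced x -> size x = #|inversions (word_perm x)|.
Proof.
move=> red_x; have [z zx sz] := word_exists (word_perm x).
by apply/eqP; rewrite eqn_leq inversions_word -sz red_x.
Qed.

Lemma size_reduced x : size x = #|inversions (word_perm x)| -> reduced x.
Proof. by move=> sx x' x'x; rewrite sx -x'x inversions_word. Qed.

Lemma reduced_rcons x k : reduced (rcons x k) -> reduced x.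
Proof.
move=> red_x z zx; have := red_x (rcons z k).
by rewrite !word_perm_rcons zx !size_rcons ltnS; apply.
Qed.

(** Otherwise [k] would be a descent of [word_perm x], and the longer reduced word would have fewer
    inversions than [x]. *)
Lemma reduced_descent x k : reduced (rcons x k) ->
  (word_perm (rcons x k) (hi k) < word_perm (rcons x k) (lo k))%N.
Proof.
move=> red_xk; rewrite ltnNge leq_eqVlt; apply/negP => /orP[|asc].
  by rewrite val_eqE (inj_eq perm_inj) -val_eqE /= ltn_eqF.
have := @inversions_descent k (word_perm x).
have := reduced_size red_xk; have := reduced_size (reduced_rcons red_xk).
move: asc; rewrite word_perm_rcons !permM tpermL tpermR size_rcons => asc.
move=> sx sxk; rewrite -sx.
have := @inversions_descent k (refl k * word_perm x)%g.
rewrite mul_reflK !permM tpermL tpermR -sxk -sx => H1 H2.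
by have := H2 asc; lia.
Qed.

(** A 321 pattern of [refl k * d] is carried by [refl k] to one of [d]: its adjacent pairs are
    inversions of [refl k * d], so none of them is [(lo k, hi k)], and the order of positions is
    kept. *)
Lemma avoids321_descent k d : avoids321 d -> (d (hi k) < d (lo k))%N ->
  avoids321 (refl k * d)%g.
Proof.
move=> av dk a b c ab bc; rewrite !permM => dcb dba.
apply: (av (refl k a) (refl k b) (refl k c)) => //; apply: refl_lt => //.
  by apply: contraTneq dba => -[-> ->]; rewrite tpermL tpermR -leqNgt ltnW.
by apply: contraTneq dcb => -[-> ->]; rewrite tpermL tpermR -leqNgt ltnW.
Qed.

(** Adjacent descents would give a 321 pattern at three consecutive places. *)
Lemma avoids321_descents_far k l d : avoids321 d ->
  (d (hi k) < d (lo k))%N -> (d (hi l) < d (lo l))%N -> l != k.+1 :> nat.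
Proof.
move=> av dk dl; apply/eqP => lk; have lh : lo l = hi k by apply: val_inj.
by apply: (av (lo k) (lo l) (hi l)) => //; rewrite ?lo_hi // lh ?lo_hi.
Qed.

Lemma refl_far k l d : k != l -> l != k.+1 :> nat -> k != l.+1 :> nat ->
  (refl l * (refl k * d) = refl k * (refl l * d))%g /\
  ((refl k * d)%g (lo l) = d (lo l) /\ (refl k * d)%g (hi l) = d (hi l)).
Proof.
rewrite -val_eqE /= => kl lk kl1.
have fix_lo : refl k (lo l) = lo l by apply: tpermD; rewrite -val_eqE /=; lia.
have fix_hi : refl k (hi l) = hi l by apply: tpermD; rewrite -val_eqE /=; lia.
split; last by rewrite !permM fix_lo fix_hi.
by rewrite !mulgA (conjgC (refl l)) tpermJ fix_lo fix_hi.
Qed.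

(* The reduced words of a 321-avoiding permutation differ by commutations
   only: two right descents are never adjacent. *)
Lemma avoids321_words (A : pzRingType) (f : 'I_n.-1 -> A) :
    (forall k l, l != k.+1 :> nat -> k != l.+1 :> nat -> f k * f l = f l * f k) ->
  forall x x', reduced x -> reduced x' -> word_perm x = word_perm x' ->
    avoids321 (word_perm x) ->
  \prod_(k <- x) f k = \prod_(k <- x') f k /\
  \prod_(k <- rev x) f k = \prod_(k <- rev x') f k.
Proof.
move=> fC x; have [m] := ubnP (size x); elim: m x => // m IHm x lt_m x'.
move=> red_x red_x' xx' av.
have sxx' : size x = size x' by rewrite !reduced_size // xx'.
case/lastP: x => [|x k] in lt_m red_x xx' av sxx' *.
  by case: x' sxx' {xx' red_x'}.
case/lastP: x' => [|x' k'] in red_x' xx' sxx' *; first by rewrite size_rcons in sxx'.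
move: (reduced_descent red_x) (reduced_descent red_x'); rewrite -xx'.
set d := word_perm (rcons x k) => dk dk'.
have red1 := reduced_rcons red_x; have red1' := reduced_rcons red_x'.
have xd : word_perm x = (refl k * d)%g by rewrite /d word_perm_rcons mul_reflK.
have x'd : word_perm x' = (refl k' * d)%g.
  by rewrite /d xx' word_perm_rcons mul_reflK.
rewrite !size_rcons ltnS in lt_m sxx'; case: sxx' => sxx'.
have prod_rcons z l : \prod_(i <- rcons z l) f i = \prod_(i <- z) f i * f l.
  by rewrite -cats1 big_cat big_seq1.
have prod_rev z l : \prod_(i <- rev (rcons z l)) f i = f l * \prod_(i <- rev z) f i.
  by rewrite rev_rcons big_cons.
have av1 : avoids321 (word_perm x) by rewrite xd; apply: avoids321_descent.
have av1' : avoids321 (word_perm x') by rewrite x'd; apply: avoids321_descent.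
have [kk'|nkk'] := eqVneq k k'.
  have [||P1 P2] // := IHm x lt_m x' red1 red1'; first by rewrite xd x'd kk'.
  by rewrite !prod_rcons !prod_rev P1 P2 kk'.
have far := avoids321_descents_far av dk dk'.
have far' := avoids321_descents_far av dk' dk.
have [comm [lo1 hi1]] := refl_far d nkk' far far'.
(* Both descents are removed at once. Then [x] is compared with [rcons z k'] and [x'] with
   [rcons z k], so the full words become [z] followed by [k', k] and by [k, k'], which differ by one
   commutation. *)
have [z zd sz] := word_exists (refl k' * (refl k * d))%g.
have zk : word_perm (rcons z k') = word_perm x.
  by rewrite word_perm_rcons zd mul_reflK xd.
have zk' : word_perm (rcons z k) = word_perm x'.
  by rewrite word_perm_rcons zd comm mul_reflK x'd.
(* [k'] is still a descent of [refl k * d], so [z] is exactly one letter shorter than [x]. *)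
have sz1 : (size z).+1 = size x.
  apply/eqP; rewrite eqn_leq {1}(reduced_size red1) sz xd inversions_descent ?lo1 ?hi1 //=.
  by have := red1 _ zk; rewrite size_rcons sz.
have redz : reduced (rcons z k').
  by apply: size_reduced; rewrite zk -reduced_size // size_rcons.
have redz' : reduced (rcons z k).
  by apply: size_reduced; rewrite zk' -reduced_size // size_rcons sz1.
have [||P1 P2] := IHm x lt_m _ red1 redz; rewrite ?zk //.
have [|||Q1 Q2] := IHm x' _ _ red1' redz'; rewrite ?zk' -?sxx' //.
split; first by rewrite !prod_rcons P1 Q1 !prod_rcons -!mulrA (fC k' k).
by rewrite !prod_rev P2 Q2 !prod_rev !mulrA (fC k k').
Qed.

End ReducedWords.

(** * Composition multiplicities under semilinear equivalences *)

(** For [rel a b := (pi a = b)] this is an isomorphism from [M] onto the inflation of [N] along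
    [pi]. A relation in place of a map makes the notion symmetric, so each transport lemma can also
    be applied backwards. *)
Record semilinear_equiv (A B : pzRingType) (rel : A -> B -> Prop)
    (M : lmodType A) (N : lmodType B) (f : M -> N) (g : N -> M) : Prop :=
  SemilinearEquiv {
    sl_fK : cancel f g;
    sl_gK : cancel g f;
    sl_add : forall x y, f (x + y) = f x + f y;
    sl_scale : forall a b x, rel a b -> f (a *: x) = b *: f x
  }.

(** For the graph of [pi] the second clause is surjectivity; it is what turns submodules over [A]
    into submodules over [B]. *)
Definition total_rel (A B : Type) (rel : A -> B -> Prop) : Prop :=
  (forall a, exists b, rel a b) /\ (forall b, exists a, rel a b).

Lemma semilinear_equiv_sym (A B : pzRingType) (rel : A -> B -> Prop)
    (M : lmodType A) (N : lmodType B) (f : M -> N) (g : N -> M) :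
  semilinear_equiv rel f g -> semilinear_equiv (fun b a => rel a b) g f.
Proof.
case=> fK gK fD fZ; split=> // [x y|b a x ab].
  by rewrite -{1}(gK x) -{1}(gK y) -fD fK.
by rewrite -{1}(gK x) -(fZ a) // fK.
Qed.

Section Transport.
Variables (A B : pzRingType) (rel : A -> B -> Prop).
Variables (M : lmodType A) (N : lmodType B) (f : M -> N) (g : N -> M).
Hypotheses (relT : total_rel rel) (fg : semilinear_equiv rel f g).

Definition transport_pred (P : {pred M}) : {pred N} := fun y => g y \in P.

Lemma sl_zero : f 0 = 0.
Proof. by apply: (addrI (f 0)); rewrite -(sl_add fg) !addr0. Qed.

Lemma transport_submod (P : {pred M}) :
  GRing.submod_closed P -> GRing.submod_closed (transport_pred P).
Proof.
have gf := semilinear_equiv_sym fg.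
case=> P0 PZ; split=> [|b x y Px Py].
  by rewrite unfold_in -sl_zero (sl_fK fg).
have [a ab] := relT.2 b.
by rewrite unfold_in (sl_add gf) (sl_scale gf _ ab); apply: PZ.
Qed.

End Transport.

Section TransportFactors.
Variables (A B : pzRingType) (rel : A -> B -> Prop).
Variables (M : lmodType A) (N : lmodType B) (f : M -> N) (g : N -> M).
Variables (L : lmodType A) (K : lmodType B) (h : L -> K) (h' : K -> L).
Hypotheses (relT : total_rel rel).
Hypotheses (fg : semilinear_equiv rel f g) (hh : semilinear_equiv rel h h').

Lemma transport_simple (P Q : {pred M}) :
  simple_factor P Q -> simple_factor (transport_pred g P) (transport_pred g Q).
Proof.
case=> PQ nPQ simp; split=> [x|eqPQ|S Smod PS SQ].
- exact: PQ.
- apply: nPQ => x; have := eqPQ (f x).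
  by rewrite !unfold_in /transport_pred (sl_fK fg).
have gf := semilinear_equiv_sym fg.
have relT' : total_rel (fun b a => rel a b) by split; case: relT.
(* A submodule between the transported ones is pulled back along [f], where simplicity of the
   original factor applies. *)
have [||y| |] := simp (transport_pred f S).
- exact: (transport_submod relT' gf).
- move=> x Px; apply: PS; rewrite unfold_in /transport_pred (sl_fK fg) //.
- by move=> Sy; have := SQ _ Sy; rewrite unfold_in /transport_pred (sl_fK fg).
- move=> SP; left=> y; have := SP (g y).
  by rewrite !unfold_in /transport_pred (sl_gK fg).
- move=> SQ'; right=> y; have := SQ' (g y).
  by rewrite !unfold_in /transport_pred (sl_gK fg).
Qed.

Lemma transport_factor_iso (P Q : {pred M}) :
  factor_iso P Q L -> factor_iso (transport_pred g P) (transport_pred g Q) K.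
Proof.
have gf := semilinear_equiv_sym fg.
case=> p [pZ p_surj p_ker]; exists (h \o p \o g); split=> [b x y Qx Qy|w|x Qx].
- have [a ab] := relT.2 b.
  by rewrite /= (sl_add gf) (sl_scale gf _ ab) pZ // (sl_add hh) (sl_scale hh _ ab).
- have [x Qx px] := p_surj (h' w); exists (f x).
    by rewrite unfold_in /transport_pred (sl_fK fg).
  by rewrite /= (sl_fK fg) px (sl_gK hh).
rewrite /= [in X in _ <-> X]unfold_in -(p_ker _ Qx); split=> [hp|->].
  by rewrite -(sl_fK hh (p (g x))) hp -(sl_zero hh) (sl_fK hh).
exact: sl_zero hh.
Qed.

Lemma transport_series k (P : nat -> {pred M}) :
  composition_series k P -> composition_series k (fun i => transport_pred g (P i)).
Proof.
case=> P0 Pk Pmod Psimp; split=> [x|x|i ik|i ik].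
- rewrite unfold_in /transport_pred P0 !inE.
  by rewrite -[RHS](can_eq (sl_gK fg)) (sl_zero (semilinear_equiv_sym fg)).
- by rewrite unfold_in /transport_pred Pk.
- exact: (transport_submod relT fg) (Pmod i ik).
- exact: transport_simple (Psimp i ik).
Qed.

End TransportFactors.

Section CompMult.
Variables (A B : pzRingType) (rel : A -> B -> Prop).
Variables (M : lmodType A) (N : lmodType B) (f : M -> N) (g : N -> M).
Variables (L : lmodType A) (K : lmodType B) (h : L -> K) (h' : K -> L).
Hypotheses (relT : total_rel rel).
Hypotheses (fg : semilinear_equiv rel f g) (hh : semilinear_equiv rel h h').

Lemma transport_factor_isoP (P Q : {pred M}) :
  factor_iso (transport_pred g P) (transport_pred g Q) K <-> factor_iso P Q L.
Proof.
split; last exact: (transport_factor_iso relT fg hh).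
have relT' : total_rel (fun b a => rel a b) by split; case: relT.
move/(transport_factor_iso relT' (semilinear_equiv_sym fg) (semilinear_equiv_sym hh)).
suff tK S : transport_pred f (transport_pred g S) = S by rewrite !tK.
by apply/functional_extensionality_dep => x; rewrite /transport_pred unfold_in (sl_fK fg).
Qed.

Lemma comp_mult_sub m :
  (exists k (P : nat -> {pred M}), composition_series k P /\
     m = \sum_(i < k) (`[< factor_iso (P i) (P i.+1) L >] : nat)) ->
  (exists k (P : nat -> {pred N}), composition_series k P /\
     m = \sum_(i < k) (`[< factor_iso (P i) (P i.+1) K >] : nat)).
Proof.
case=> k [P [serP ->]]; exists k, (fun i => transport_pred g (P i)).
split; first exact: (transport_series relT fg).
apply: eq_bigr => i _; congr nat_of_bool.
by apply: asbool_equiv_eq; symmetry; apply: transport_factor_isoP.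
Qed.

End CompMult.

(** Composition series are transported in both directions together with their counts. So the two
    sets of candidate multiplicities coincide, and [xget] returns the same value, also in the
    default case of an empty set. *)
Lemma comp_mult_equiv (A B : pzRingType) (rel : A -> B -> Prop)
    (M : lmodType A) (N : lmodType B) (f : M -> N) (g : N -> M)
    (L : lmodType A) (K : lmodType B) (h : L -> K) (h' : K -> L) :
  total_rel rel -> semilinear_equiv rel f g -> semilinear_equiv rel h h' ->
  comp_mult M L = comp_mult N K.
Proof.
move=> relT fg hh; congr (classical_sets.xget _ _).
apply/funext => m; apply/propext.
have relT' : total_rel (fun b a => rel a b) by split; case: relT.
split; first exact: (comp_mult_sub relT fg hh).
exact: (comp_mult_sub relT' (semilinear_equiv_sym fg) (semilinear_equiv_sym hh)).
Qed.

(** * Bipartitions as r-partitions supported on two components *)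

Section Embedding.
Variables (r n : nat) (u v : 'I_r).
Hypothesis lt_uv : (u < v)%N.

(** The values of such a tableau list [nodes lam] in strictly increasing order. Uniqueness is needed
    because [tinit] is only an [xchoose] witness, to be compared with the embedding of another
    one. *)
Lemma initial_uniq (lam : onecol r n) s t :
  is_initial lam s -> is_initial lam t -> s = t.
Proof.
pose lt := relpre (@node_val r n) (@node_lt r).
have lt_irr : irreflexive lt by move=> g; rewrite /lt /= /node_lt !ltnn andbF.
have lt_trans : transitive lt.
  move=> [b m] [a l] [c p]; rewrite /lt /= /node_lt /=.
  by clear; lia.
have sortedP t' : is_initial lam t' ->
    sorted lt (codom t') /\ codom t' =i nodes lam.
  case/andP => /andP[_ /eqP <-] /forallP inc; split; last first.
    by move=> g; apply/codomP/imsetP => [[k ->]|[k _ ->]]; exists k.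
  rewrite /codom /image_mem sorted_map.
  have : sorted (relpre val ltn) (enum 'I_n).
    by rewrite -sorted_map val_enum_ord iota_ltn_sorted.
  by apply: sub_sorted => k l kl; have /forallP/(_ l)/implyP := inc k; apply.
move=> /sortedP[sort_s mem_s] /sortedP[sort_t mem_t].
have : codom s = codom t.
  by apply: (irr_sorted_eq lt_trans lt_irr) => // g; rewrite mem_s mem_t.
by move/eq_in_map => st; apply/ffunP => k; apply: st; rewrite mem_enum.
Qed.

Definition emb_node (g : node 2 n) : node r n := (g.1, pair_ord u v g.2).

Definition emb_tab (t : {ffun 'I_n -> node 2 n}) : {ffun 'I_n -> node r n} :=
  [ffun k => emb_node (t k)].

Lemma pair_ord_inj : injective (pair_ord u v).
Proof.
move=> a b; rewrite /pair_ord.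
case: (eqVneq a ord0) (eqVneq b ord0) => [->|na] [->|nb] // uv.
- by move: lt_uv; rewrite uv ltnn.
- by move: lt_uv; rewrite uv ltnn.
by apply: val_inj; move: na nb; rewrite -!val_eqE /=; case: a b => -[|[]] // ? [[|[]]].
Qed.

(** Since [u < v], the two columns keep their relative order, which the node order uses within a
    row. *)
Lemma pair_ord_lt a b : (pair_ord u v a < pair_ord u v b)%N = (a < b)%N.
Proof.
by case: a b => -[|[]] // ? [[|[]]] // ?; rewrite /pair_ord -?val_eqE /= ?ltnn //;
  rewrite ltnNge ltnW.
Qed.

Lemma emb_node_inj : injective emb_node.
Proof. by move=> [a l] [b m] [-> /pair_ord_inj ->]. Qed.

Lemma emb_node_lt g h : node_lt (node_val (emb_node g)) (node_val (emb_node h))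
  = node_lt (node_val g) (node_val h).
Proof. by rewrite /node_lt /= pair_ord_lt. Qed.

Lemma emb_tab_inj : injective emb_tab.
Proof.
by move=> s t /ffunP st; apply/ffunP => k; have := st k; rewrite !ffunE => /emb_node_inj.
Qed.

(** A relation, since the theorem supplies [lam'] and [mu'] from outside, while for the lower shapes
    a restriction is produced by [restriction_exists]. *)
Definition restricts (nu : onecol r n) (nu' : onecol 2 n) : Prop :=
  (forall l, l != u -> l != v -> nu l = 0%N) /\ nu' =1 pair_ord (nu u) (nu v).

Section Restriction.
Variables (nu : onecol r n) (nu' : onecol 2 n).
Hypothesis nuP : restricts nu nu'.

Lemma col_emb l : nu (pair_ord u v l) = nu' l.
Proof. by rewrite nuP.2 /pair_ord; case: ifP. Qed.

Lemma nodes_emb : nodes nu = [set emb_node g | g in nodes nu']%SET.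
Proof.
apply/setP => -[a l]; rewrite inE /=; apply/idP/imsetP => [al|[[b m]]]; last first.
  by rewrite inE /= -col_emb => bm [-> ->].
have [lu|lv] : l = u \/ l = v.
  have [->|lu] := eqVneq l u; first by left.
  have [->|lv] := eqVneq l v; first by right.
  by rewrite (nuP.1 _ lu lv) in al.
- by exists (a, ord0); rewrite ?inE /emb_node /= -?col_emb /pair_ord lu in al *.
by exists (a, ord_max); rewrite ?inE /emb_node /= -?col_emb /pair_ord lv in al *.
Qed.

Lemma emb_tableau t : is_tableau nu (emb_tab t) = is_tableau nu' t.
Proof.
congr andb.
  apply/injectiveP/injectiveP => inj k l; last by rewrite !ffunE => /emb_node_inj/inj.
  by move=> tkl; apply: inj; rewrite !ffunE tkl.
rewrite nodes_emb -(inj_eq (imset_inj emb_node_inj)) -imset_comp.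
by congr (_ == _); apply: eq_imset => k; rewrite ffunE.
Qed.

Lemma emb_standard t : is_standard nu (emb_tab t) = is_standard nu' t.
Proof.
rewrite /is_standard emb_tableau; congr andb.
apply: eq_forallb => k; apply: eq_forallb => l.
by rewrite !ffunE /= (inj_eq pair_ord_inj).
Qed.

Lemma emb_initial t : is_initial nu (emb_tab t) = is_initial nu' t.
Proof.
rewrite /is_initial emb_tableau; congr andb.
by apply: eq_forallb => k; apply: eq_forallb => l; rewrite !ffunE emb_node_lt.
Qed.

Lemma tinit_initial m (lam : onecol m n) : is_initial lam (tinit lam).
Proof. exact: xchooseP. Qed.

Lemma tinit_emb : tinit nu = emb_tab (tinit nu').
Proof.
by apply: (@initial_uniq nu); rewrite ?emb_initial; apply: tinit_initial.
Qed.

Definition emb_std (t : Std nu') : Std nu :=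
  exist _ (emb_tab (val t)) (etrans (emb_standard (val t)) (valP t)).

(** For surjectivity, the values of a tableau of shape [nu] lie in [nodes nu], hence lift node by
    node along [emb_node]; [emb_standard] read backwards makes the lift standard. *)
Lemma emb_std_bij : bijective emb_std.
Proof.
have inj : injective emb_std.
  by move=> s t /(congr1 val) /= /emb_tab_inj/val_inj.
have surj t : exists s, emb_std s == t.
  have tP k : val t k \in nodes nu.
    by case/andP: (valP t) => /andP[_ /eqP <-] _; apply: imset_f.
  have {}tP k : exists g, emb_node g == val t k.
    by have := tP k; rewrite nodes_emb => /imsetP[g _ ->]; exists g.
  pose s := [ffun k => xchoose (tP k)].
  have st : emb_tab s = val t.
    by apply/ffunP => k; rewrite !ffunE; apply/eqP/(xchooseP (tP k)).
  have s_std : is_standard nu' s by rewrite -emb_standard st; apply: valP.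
  by exists (exist _ s s_std); apply/eqP/val_inj.
exists (fun t => xchoose (surj t)) => [s|t]; last exact/eqP/(xchooseP (surj t)).
exact/inj/eqP/(xchooseP (surj _)).
Qed.

(** The initial tableaux correspond under the injective [emb_tab], so the same permutations solve
    both defining equations and [pick] sees equal predicates. *)
Lemma dperm_emb t : dperm (emb_std t) = dperm t.
Proof.
congr odflt; apply: eq_pick => d; rewrite /= tinit_emb -(inj_eq emb_tab_inj).
by congr (_ == _); apply/ffunP => k; rewrite !ffunE.
Qed.

Lemma residue_emb e (j : 'I_r -> Zmod e) g :
  residue j (emb_node g) = residue (pair_ord (j u) (j v)) g.
Proof. by rewrite /residue /emb_node /= /pair_ord; case: ifP. Qed.

(** The dominance test of [nu'] at a node is that of [nu] at the embedded node, so dominance passes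
    to restrictions. *)
Lemma count_emb (g0 : nat * 'I_2) :
  #|[pred g in nodes nu | node_le (node_val g) (g0.1, pair_ord u v g0.2)]|
  = #|[pred g in nodes nu' | node_le (node_val g) g0]|.
Proof.
rewrite -(card_image emb_node_inj); apply: eq_card => g.
rewrite inE nodes_emb; apply/andP/imageP => [[/imsetP[h h_nu ->]]|[h]].
  move=> le; exists h => //; rewrite inE h_nu; move: le.
  by rewrite /node_le /node_lt /= pair_ord_lt !xpair_eqE (inj_eq pair_ord_inj).
rewrite inE => /andP[h_nu le] ->; split; first exact: imset_f.
move: le.
by rewrite /node_le /node_lt /= pair_ord_lt !xpair_eqE (inj_eq pair_ord_inj).
Qed.

End Restriction.

Lemma restriction_exists (nu : onecol r n) :
  (forall l, l != u -> l != v -> nu l = 0%N) -> exists nu', restricts nu nu'.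
Proof.
move=> supp; pose c : {ffun 'I_2 -> nat} := [ffun l => pair_ord (nu u) (nu v) l].
have c_sum : \sum_l c l = n.
  rewrite -[RHS](col_sum nu) (bigD1 u) // (bigD1 v) /=; last first.
    by rewrite -val_eqE gtn_eqF.
  rewrite [X in _ + (_ + X)]big1 ?addr0; last by move=> l /andP[]; apply: supp.
  by rewrite big_ord_recl big_ord1 !ffunE.
by exists (OneCol c_sum); split=> // l; rewrite /= ffunE.
Qed.

Lemma onecol_eq m (nu lam : onecol m n) : nu =1 lam -> nu = lam.
Proof.
case: nu lam => [c cs] [d ds] /= /ffunP cd; subst d.
by congr OneCol; apply: eq_irrelevance.
Qed.

Lemma dom_lt_restricts nu nu' lam lam' :
  restricts nu nu' -> restricts lam lam' -> dom_lt nu lam -> dom_lt nu' lam'.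
Proof.
move=> nuP lamP [le ne]; split.
  by move=> g0; rewrite -(count_emb nuP) -(count_emb lamP); apply: le.
(* Strictness survives because both shapes vanish outside [u] and [v] and are thus determined by
   their restrictions. *)
move=> eq'; apply: ne; apply: onecol_eq => l.
have [->|lu] := eqVneq l u.
  by have := nuP.2 ord0; rewrite eq' (lamP.2 ord0).
have [->|lv] := eqVneq l v.
  by have := nuP.2 ord_max; rewrite eq' (lamP.2 ord_max).
by rewrite nuP.1 // lamP.1.
Qed.

End Embedding.

Lemma onecol2_notin_D n (lam : onecol 2 n) : ~~ in_D lam.
Proof. by rewrite /in_D -ltnNge (leq_ltn_trans (max_card _)) // card_ord. Qed.

(** Among three entries two share a column. Rows increase with the entries along a column both in
    [t] and in the initial tableau, so [dperm t] has no inversion inside a column. *)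
Lemma dperm_avoids321 n (lam : onecol 2 n) (t : Std lam) : avoids321 (dperm t).
Proof.
(* In the default case of [pick] the permutation is [1], which has no inversion. *)
rewrite /dperm; case: pickP => [d /eqP td|_] /=; last first.
  by move=> a b c ab bc; rewrite !perm1 => cb; have := ltn_trans bc cb; rewrite ltnn.
have /andP[_ /forallP inc] := tinit_initial lam.
have /andP[_ /forallP std] := valP t.
have same_col (a b : 'I_n) : (val t a).2 = (val t b).2 -> (a < b)%N ->
    (d b < d a)%N -> False.
  move=> col_ab ab dba; have /forallP/(_ (d a))/implyP/(_ dba) := inc (d b).
  have := std b => /forallP/(_ a)/implyP; rewrite col_ab eqxx /= => stdba.
  have : ((val t a).2 = (val t b).2) := col_ab; rewrite td !ffunE => cc.
  rewrite /node_lt /= cc ltnn andbF orbF => lt_ba.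
  have := stdba; rewrite td !ffunE => /(_ lt_ba).
  by rewrite ltnNge ltnW.
move=> a b c ab bc dcb dba.
have [ab_col|nab] := eqVneq (val t a).2 (val t b).2; first exact: (same_col a b).
have [bc_col|nbc] := eqVneq (val t b).2 (val t c).2; first exact: (same_col b c).
(* There are only two columns, and that of [b] differs from those of [a] and [c]. *)
apply: (same_col a c); [|exact: ltn_trans bc|exact: ltn_trans dba].
apply: val_inj; move: nab nbc; rewrite -!val_eqE /=.
by case: (val t a).2 (val t b).2 (val t c).2 => -[|[]] // ? [[|[]]] // ? [[|[]]].
Qed.

(** * Cell modules and their heads *)

Section QuotientEquiv.
Variables (A B : pzRingType) (rel : A -> B -> Prop).
Variables (M : lmodType A) (N : lmodType B) (f : M -> N) (g : N -> M).
Variables (L : lmodType A) (K : lmodType B).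
Variables (p : {linear M -> L}) (p' : {linear N -> K}).
Hypotheses (relT : total_rel rel) (fg : semilinear_equiv rel f g).
Hypotheses (p_surj : forall l, exists x, p x = l).
Hypotheses (p'_surj : forall k, exists y, p' y = k).
Hypothesis ker_p : forall x, p x = 0 <-> p' (f x) = 0.

(** [f] matches the kernels of [p] and [p'], so it descends to the quotients. The maps use chosen
    sections of [p] and [p']; [hp] and [h'p'] show that the choice is immaterial. *)
Lemma quotient_equiv :
  exists (h : L -> K) (h' : K -> L), semilinear_equiv rel h h'.
Proof.
have gf := semilinear_equiv_sym fg.
have [s ps] := choice p_surj; have [s' p's'] := choice p'_surj.
pose h l := p' (f (s l)); pose h' k := p (g (s' k)).
have fB x y : f (x - y) = f x - f y.
  by apply: (addIr (f y)); rewrite -(sl_add fg) !subrK.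
have gB x y : g (x - y) = g x - g y.
  by apply: (addIr (g y)); rewrite -(sl_add gf) !subrK.
have hp x : h (p x) = p' (f x).
  apply/eqP; rewrite -subr_eq0 -raddfB -fB; apply/eqP/ker_p.
  by rewrite linearB /= ps subrr.
have h'p' y : h' (p' y) = p (g y).
  apply/eqP; rewrite -subr_eq0 -raddfB -gB; apply/eqP/ker_p.
  by rewrite (sl_gK fg) linearB /= p's' subrr.
exists h, h'; split=> [l|k|l l'|a b l ab].
- by rewrite /h h'p' (sl_fK fg) ps.
- by rewrite /h' hp (sl_gK fg) p's'.
- by rewrite -{1}(ps l) -{1}(ps l') -raddfD hp (sl_add fg) raddfD.
- by rewrite -{1}(ps l) -linearZ hp (sl_scale fg _ ab) linearZ.
Qed.

End QuotientEquiv.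

(** * Modules with matching bases and matching matrices *)

Section BasisEquiv.
Variables (R : fieldType) (A B : pzAlgType R) (pi : A -> B).
Variables (T T' : finType) (sigma : T' -> T).
Hypothesis sigma_bij : bijective sigma.
Variables (W : lmodType A) (C : T -> W) (W' : lmodType B) (C' : T' -> W').

(** This is the first clause of [is_cell_module], so that [W_cell.1] can be passed directly. *)
Definition is_basis (D : pzAlgType R) (V : lmodType D) (I : finType) (b : I -> V) :=
  forall x : V, exists! c : {ffun I -> R}, x = \sum_s (scal (c s) : D) *: b s.

Hypotheses (C_basis : is_basis C) (C'_basis : is_basis C').
Hypothesis C_act : forall (a : A) (rho : T -> T -> R),
  (forall s, a *: C s = \sum_s' (scal (rho s' s) : A) *: C s') ->
  forall s, pi a *: C' s
    = \sum_s' (scal (rho (sigma s') (sigma s)) : B) *: C' s'.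

Lemma basis_coord (D : pzAlgType R) (V : lmodType D) (I : finType) (b : I -> V) :
  is_basis b -> exists co : V -> I -> R,
    (forall x, x = \sum_s (scal (co x s) : D) *: b s) /\
    (forall c : I -> R, co (\sum_s (scal (c s) : D) *: b s) =1 c).
Proof.
move=> b_basis.
have /choice[co coP] : forall x, exists c : {ffun I -> R},
    x = \sum_s (scal (c s) : D) *: b s.
  by move=> x; have [c [xc _]] := b_basis x; exists c.
exists co; split=> // c s; set x := \sum_s _ *: _.
have [d [_ d_uniq]] := b_basis x.
have <- := d_uniq _ (coP x); have -> : d = [ffun i => c i]; last by rewrite ffunE.
by apply: d_uniq; apply: eq_bigr => i _; rewrite ffunE.
Qed.

(** [f] keeps the coordinates and relabels the basis along [sigma]. It is semilinear because [pi a]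
    acts on [C'] by the relabelled matrix of [a] on [C], the scalars being central. *)
Lemma basis_equiv : exists (f : W -> W') (g : W' -> W),
  semilinear_equiv (fun a b => pi a = b) f g /\
  forall c : T -> R, f (\sum_s (scal (c s) : A) *: C s)
    = \sum_s (scal (c (sigma s)) : B) *: C' s.
Proof.
have [co [coE coK]] := basis_coord C_basis.
have [co' [co'E co'K]] := basis_coord C'_basis.
have [tau sigmaK tauK] := sigma_bij.
have re (V : zmodType) (F : T -> V) : \sum_t F t = \sum_s F (sigma s).
  by rewrite (reindex sigma) //; apply: onW_bij.
pose f x := \sum_s (scal (co x (sigma s)) : B) *: C' s.
pose g y := \sum_t (scal (co' y (tau t)) : A) *: C t.
exists f, g; split; last by move=> c; apply: eq_bigr => s _; rewrite coK.
split=> [x|y|x y|a b x <-].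
- by rewrite /g [RHS]coE; apply: eq_bigr => t _; rewrite co'K tauK.
- by rewrite /f [RHS]co'E; apply: eq_bigr => s _; rewrite coK sigmaK.
- have coD : co (x + y) =1 (fun t => co x t + co y t).
    rewrite {1}(coE x) {1}(coE y) -big_split /=.
    under eq_bigr do rewrite -scalerDl -raddfD.
    exact: coK.
  by rewrite /f -big_split; apply: eq_bigr => s _; rewrite coD raddfD scalerDl.
(* The matrix of [a] in the basis [C], to which [C_act] applies. *)
pose rho t' t := co (a *: C t) t'.
have aC t : a *: C t = \sum_t' (scal (rho t' t) : A) *: C t' := coE _.
have coZ : co (a *: x) =1 (fun t' => \sum_t rho t' t * co x t).
  rewrite {1}(coE x) scaler_sumr.
  have -> : \sum_t a *: ((scal (co x t) : A) *: C t) =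
      \sum_t' (scal (\sum_t rho t' t * co x t) : A) *: C t'.
    under eq_bigr do rewrite scalerA -scalC -scalerA aC scaler_sumr.
    rewrite exchange_big; apply: eq_bigr => t' _.
    rewrite raddf_sum scaler_suml; apply: eq_bigr => t _.
    by rewrite scalerA -rmorphM mulrC.
  exact: coK.
rewrite /f scaler_sumr.
under [RHS]eq_bigr do
  rewrite scalerA -scalC -scalerA (C_act aC) scaler_sumr.
rewrite exchange_big; apply: eq_bigr => s' _.
rewrite coZ re raddf_sum scaler_suml; apply: eq_bigr => s _.
by rewrite scalerA -rmorphM mulrC.
Qed.

End BasisEquiv.

(** * Bilinear forms in coordinates *)

Section BilinearForm.
Variables (R : fieldType) (A : pzAlgType R) (W : lmodType A) (phi : W -> W -> R).
Hypothesis phi_l : forall (c : R) u v x,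
  phi ((scal c : A) *: u + v) x = c * phi u x + phi v x.
Hypothesis phi_r : forall (c : R) u v x,
  phi x ((scal c : A) *: u + v) = c * phi x u + phi x v.

Lemma form_sum (T : finType) (c d : T -> R) (C : T -> W) :
  phi (\sum_s (scal (c s) : A) *: C s) (\sum_s (scal (d s) : A) *: C s)
  = \sum_s \sum_t c s * (d t * phi (C s) (C t)).
Proof.
have phi0l x : phi 0 x = 0.
  by have /eqP := phi_l 1 0 0 x; rewrite scaler0 addr0 mul1r -subr_eq0 opprD
    addrA subrr sub0r oppr_eq0 => /eqP.
have phi0r x : phi x 0 = 0.
  by have /eqP := phi_r 1 0 0 x; rewrite scaler0 addr0 mul1r -subr_eq0 opprD
    addrA subrr sub0r oppr_eq0 => /eqP.
rewrite (big_morph (phi^~ _) (id1 := 0) (op1 := +%R)) // => [|x y]; last first.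
  by rewrite -[x]scale1r -(rmorph1 scal) phi_l mul1r rmorph1 scale1r.
apply: eq_bigr => s _; rewrite -mulr_sumr -[_ *: C s]addr0 phi_l phi0l addr0.
congr (_ * _).
rewrite (big_morph (phi _) (id1 := 0) (op1 := +%R)) // => [|x y]; last first.
  by rewrite -[x]scale1r -(rmorph1 scal) phi_r mul1r rmorph1 scale1r.
by apply: eq_bigr => t _; rewrite -[_ *: C t]addr0 phi_r phi0r addr0.
Qed.

End BilinearForm.

Lemma form_transport (R : fieldType) (A B : pzAlgType R)
    (W : lmodType A) (W' : lmodType B) (phi : W -> W -> R) (phi' : W' -> W' -> R)
    (T T' : finType) (sigma : T' -> T) (C : T -> W) (C' : T' -> W') (f : W -> W') :
    (forall (c : R) u v x, phi ((scal c : A) *: u + v) x = c * phi u x + phi v x) ->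
    (forall (c : R) u v x, phi x ((scal c : A) *: u + v) = c * phi x u + phi x v) ->
    (forall (c : R) u v x,
       phi' ((scal c : B) *: u + v) x = c * phi' u x + phi' v x) ->
    (forall (c : R) u v x,
       phi' x ((scal c : B) *: u + v) = c * phi' x u + phi' x v) ->
    bijective sigma -> is_basis C ->
    (forall c : T -> R, f (\sum_s (scal (c s) : A) *: C s)
       = \sum_s (scal (c (sigma s)) : B) *: C' s) ->
    (forall s t, phi' (C' s) (C' t) = phi (C (sigma s)) (C (sigma t))) ->
  forall x y, phi' (f x) (f y) = phi x y.
Proof.
move=> phi_l phi_r phi'_l phi'_r sigma_bij C_basis fE CE x y.
have [c [-> _]] := C_basis x; have [d [-> _]] := C_basis y.
rewrite (fE c) (fE d) (form_sum phi_l phi_r) (form_sum phi'_l phi'_r).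
rewrite [RHS](reindex sigma) /=; last exact: onW_bij.
apply: eq_bigr => s _; rewrite [RHS](reindex sigma) /=; last exact: onW_bij.
by apply: eq_bigr => t _; rewrite CE.
Qed.

(** * Linear spans and their images under algebra morphisms *)

Section Span.
Variables (R : pzRingType) (A : pzAlgType R).

(* [lower_span w lam] is [span_of (lower_cell w lam)]. *)
Definition span_of (P : A -> Prop) (z : A) : Prop :=
  exists m (c : 'I_m -> R) (u : 'I_m -> A),
    (forall i, P (u i)) /\ z = \sum_i scal (c i) * u i.

Variable P : A -> Prop.

Lemma span_of0 : span_of P 0.
Proof.
exists 0%N, (fun=> 0), (fun=> 0); split; first by case.
by rewrite big_ord0.
Qed.

Lemma span_of_in x : P x -> span_of P x.
Proof.
move=> Px; exists 1%N, (fun=> 1), (fun=> x); split=> //.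
by rewrite big_ord1 rmorph1 mul1r.
Qed.

Lemma span_ofD x y : span_of P x -> span_of P y -> span_of P (x + y).
Proof.
case=> m [c [z [zP ->]]] [m' [c' [z' [z'P ->]]]].
pose glue (V : Type) (a : 'I_m -> V) (b : 'I_m' -> V) i :=
  match split i with inl k => a k | inr k => b k end.
exists (m + m')%N, (glue R c c'), (glue _ z z'); split.
  by move=> i; rewrite /glue; case: split.
have glue_l V a b i : glue V a b (lshift m' i) = a i.
  by rewrite /glue -[lshift m' i]/(unsplit (inl i)) unsplitK.
have glue_r V a b i : glue V a b (rshift m i) = b i.
  by rewrite /glue -[rshift m i]/(unsplit (inr i)) unsplitK.
rewrite big_split_ord /=; congr (_ + _); apply: eq_bigr => i _.
  by rewrite !glue_l.
by rewrite !glue_r.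
Qed.

Lemma span_ofZ c x : span_of P x -> span_of P (scal c * x).
Proof.
case=> m [d [z [zP ->]]]; exists m, (fun i => c * d i), z; split=> //.
by rewrite mulr_sumr; apply: eq_bigr => i _; rewrite rmorphM mulrA.
Qed.

End Span.

(** The alternative [pi x = 0] is meant for the cell elements whose shape leaves the two
    components. *)
Lemma span_of_map (R : pzRingType) (A B : pzAlgType R) (pi : {rmorphism A -> B})
    (P : A -> Prop) (Q : B -> Prop) :
  (forall c, pi (scal c) = scal c) -> (forall x, P x -> pi x = 0 \/ Q (pi x)) ->
  forall x, span_of P x -> span_of Q (pi x).
Proof.
move=> pi_scal PQ x [m [c [u [uP ->]]]]; rewrite rmorph_sum.
apply: big_ind => [|a b|i _]; [exact: span_of0|exact: span_ofD|].
rewrite rmorphM pi_scal; have [->|Qu] := PQ _ (uP i).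
  by rewrite mulr0; apply: span_of0.
exact/span_ofZ/span_of_in.
Qed.

Definition lower_cell (R : fieldType) (e r n : nat) (j : 'I_r -> Zmod e)
    (w : word_family r n) (lam : onecol r n) (z : TL R (sum_fund_weights j) n) :=
  exists nu (s t : Std nu),
    [/\ ~~ in_D nu, dom_lt nu lam & z = cell_elt R j w s t].

(** * The surjection on cell elements, cell modules and cell forms *)

Section CellRestriction.
Variables (R : fieldType) (e r n : nat) (j : 'I_r -> Zmod e) (u v : 'I_r).
Hypothesis j_far : forall a b, a != b -> (2 < Idist (j a) (j b))%N.
Hypothesis lt_uv : (u < v)%N.
Variables (w : word_family r n) (w' : word_family 2 n).
Hypotheses (w_official : official w) (w'_official : official w').

Local Notation j' := (pair_ord (j u) (j v)).
Local Notation A := (TL R (sum_fund_weights j) n).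
Local Notation B := (TL R (sum_fund_weights j') n).
Local Notation restricts := (restricts u v).

Variable pi : {rmorphism A -> B}.
Hypothesis pi_scal : forall c, pi (scal c) = scal c.
Hypothesis pi_psi : forall k, pi (tl_psi R _ k) = tl_psi R _ k.
Hypothesis pi_idem : forall i, pi (tl_idem R _ i) = tl_idem R _ i.

Lemma pi_psi_word x : pi (psi_word R j x) = psi_word R j' x.
Proof. by rewrite rmorph_prod; apply: eq_bigr => k _; apply: pi_psi. Qed.

Lemma pi_idem_of nu nu' : restricts nu nu' ->
  pi (idem_of R j nu) = idem_of R j' nu'.
Proof.
move=> nuP; rewrite pi_idem; congr tl_idem; apply/ffunP => k.
by rewrite !ffunE (tinit_emb lt_uv nuP) ffunE residue_emb.
Qed.

(** The first node of component [l] has residue [j l]. In the initial tableau it is preceded only by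
    first-row nodes of smaller columns, whose residues are [j a] with [a != l], so [tl_idem_far]
    applies. *)
Lemma pi_idem_of_eq0 (nu : onecol r n) l : l != u -> l != v -> (0 < nu l)%N ->
  pi (idem_of R j nu) = 0.
Proof.
move=> lu lv nul; rewrite pi_idem.
have n_gt0 : (0 < n)%N.
  by rewrite -(col_sum nu) (bigD1 l) //= (leq_trans nul) // leq_addr.
have /andP[/andP[_ /eqP img] /forallP inc] := tinit_initial nu.
have : (Ordinal n_gt0, l) \in nodes nu by rewrite inE.
rewrite -img => /imsetP[k _ tk].
have ik : residue j (tinit nu k) = j l by rewrite /residue -tk /= raddf0 subr0.
set i := (X in tl_idem _ _ X); suff i0 : idem R (sum_fund_weights j') i = 0.
  by rewrite /tl_idem i0; apply: to_quot0.
apply: (tl_idem_far R j_far _ lu lv (k := k)); first by rewrite ffunE.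
move=> m mk; have /forallP/(_ k)/implyP/(_ mk) := inc m.
rewrite -tk /node_lt /= => /andP[/eqP m0 ml].
exists (tinit nu m).2; first by rewrite -val_eqE ltn_eqF.
by rewrite ffunE /residue m0 raddf0 subr0.
Qed.

(** By [dperm_emb] both chosen words are reduced words of one permutation, which avoids 321 since
    [nu'] has two columns; hence they differ by commutations. *)
Lemma psi_words nu nu' (nuP : restricts nu nu') (t : Std nu') : ~~ in_D nu ->
  psi_word R j' (w (emb_std lt_uv nuP t)) = psi_word R j' (w' t) /\
  psi_word R j' (rev (w (emb_std lt_uv nuP t))) = psi_word R j' (rev (w' t)).
Proof.
move=> nuD.
have [wd red _] := w_official nuD (emb_std lt_uv nuP t).
have [w'd red' _] := w'_official (onecol2_notin_D nu') t.
have psiC := @tl_psiC R e n (sum_fund_weights j').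
have [||P1 P2] := avoids321_words psiC red red'.
- by rewrite wd w'd dperm_emb.
- by rewrite wd dperm_emb; apply: dperm_avoids321.
by split; [exact: P1|exact: P2].
Qed.

Lemma pi_cell_elt nu nu' (nuP : restricts nu nu') (s t : Std nu') : ~~ in_D nu ->
  pi (cell_elt R j w (emb_std lt_uv nuP s) (emb_std lt_uv nuP t))
  = cell_elt R j' w' s t.
Proof.
move=> nuD; rewrite /cell_elt !rmorphM !pi_psi_word (pi_idem_of nuP).
by rewrite (psi_words nuP s nuD).2 (psi_words nuP t nuD).1.
Qed.

Lemma pi_cell_elt_eq0 (nu : onecol r n) (s t : Std nu) l : l != u -> l != v -> (0 < nu l)%N ->
  pi (cell_elt R j w s t) = 0.
Proof.
move=> lu lv nul; rewrite /cell_elt !rmorphM (pi_idem_of_eq0 lu lv nul).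
by rewrite mulr0 mul0r.
Qed.

(** A lower cell element of shape [nu] dies if [nu] meets a component other than [u] and [v].
    Otherwise [nu] has a restriction, still below [lam'], and both tableaux are embedded ones. *)
Lemma pi_cell_congr lam lam' (x y : A) (x' y' : B) : restricts lam lam' ->
  cell_congr w lam x y -> pi x = x' -> pi y = y' -> cell_congr w' lam' x' y'.
Proof.
move=> lamP xy <- <-; move: xy; rewrite /cell_congr -rmorphB.
apply: (span_of_map (P := lower_cell w lam) (Q := lower_cell w' lam')) => //.
move=> z [nu [s [t [nuD nu_lam ->]]]].
have [/existsP[l /and3P[lu lv nul]]|/existsPn supp] :=
    boolP [exists l, [&& l != u, l != v & (0 < nu l)%N]].
  by left; apply: (pi_cell_elt_eq0 _ _ lu lv nul).
have [|nu' nuP] := @restriction_exists r n u v lt_uv nu.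
  move=> l lu lv; apply/eqP; have := supp l.
  by rewrite lu lv /= lt0n negbK.
have [tau sigmaK tauK] := emb_std_bij lt_uv nuP.
right; exists nu', (tau s), (tau t); split; first exact: onecol2_notin_D.
  exact: (dom_lt_restricts lt_uv nuP lamP nu_lam).
by have := pi_cell_elt nuP (tau s) (tau t) nuD; rewrite !tauK.
Qed.

Section CellModule.
Variables (lam : onecol r n) (lam' : onecol 2 n).
Hypotheses (lamD : ~~ in_D lam) (lamP : restricts lam lam').
Variables (W : lmodType A) (C : Std lam -> W) (W' : lmodType B) (C' : Std lam' -> W').
Hypotheses (W_cell : is_cell_module w C) (W'_cell : is_cell_module w' C').

Local Notation sigma := (emb_std lt_uv lamP).

(** A matrix describes the action exactly when it satisfies the congruences on cell elements: those
    for [a] are read off [W], mapped by [pi], and turned back into the action on [W']. *)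
Lemma cell_action (a : A) (rho : Std lam -> Std lam -> R) :
  (forall s, a *: C s = \sum_s' (scal (rho s' s) : A) *: C s') ->
  forall s, pi a *: C' s
    = \sum_s' (scal (rho (sigma s') (sigma s)) : B) *: C' s'.
Proof.
move/W_cell.2 => aC; apply/W'_cell.2 => s t.
apply: (pi_cell_congr lamP (aC (sigma s) (sigma t))).
  by rewrite rmorphM (pi_cell_elt lamP s t lamD).
rewrite rmorph_sum (reindex sigma) /=; last exact/onW_bij/emb_std_bij.
apply: eq_bigr => s' _.
by rewrite rmorphM pi_scal (pi_cell_elt lamP s' t lamD).
Qed.

(** The congruence that characterizes a value of [phi] is mapped by [pi] to the one that
    characterizes the value of [phi']. *)
Lemma cell_form_restriction phi phi' : is_cell_form w C phi ->
  is_cell_form w' C' phi' ->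
  forall s t, phi' (C' t) (C' s) = phi (C (sigma t)) (C (sigma s)).
Proof.
move=> [_ _ phiP] [_ _ phi'P] s t; apply/phi'P => s' t'.
have st := (phiP (sigma s) (sigma t) _).1 erefl (sigma s') (sigma t').
apply: (pi_cell_congr lamP st); rewrite rmorphM.
  exact: (congr2 *%R (pi_cell_elt lamP s' t lamD) (pi_cell_elt lamP s t' lamD)).
by rewrite pi_scal (pi_cell_elt lamP s' t' lamD).
Qed.

Lemma cell_module_equiv : exists (f : W -> W') (g : W' -> W),
  semilinear_equiv (fun a b => pi a = b) f g /\
  forall phi phi', is_cell_form w C phi -> is_cell_form w' C' phi' ->
    forall x y, phi' (f x) (f y) = phi x y.
Proof.
have sigma_bij := emb_std_bij lt_uv lamP.
have [f [g [fg fE]]] := basis_equiv sigma_bij W_cell.1 W'_cell.1 cell_action.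
exists f, g; split=> // phi phi' form form'.
have [phi_l phi_r _] := form; have [phi'_l phi'_r _] := form'.
apply: (form_transport phi_l phi_r phi'_l phi'_r sigma_bij W_cell.1 fE) => s t.
exact: (cell_form_restriction form form').
Qed.

End CellModule.

Lemma cell_head_equiv lam lam' (lamD : ~~ in_D lam) (lamP : restricts lam lam')
    (W : lmodType A) (C : Std lam -> W) (W' : lmodType B) (C' : Std lam' -> W')
    (L : lmodType A) (L' : lmodType B) :
  (forall b, exists a, pi a = b) ->
  is_cell_module w C -> is_cell_module w' C' ->
  is_cell_head w C L -> is_cell_head w' C' L' ->
  exists (h : L -> L') (h' : L' -> L),
    semilinear_equiv (fun a b => pi a = b) h h'.
Proof.
move=> pi_surj W_cell W'_cell [phi [p [form p_surj p_ker]]].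
move=> [phi' [p' [form' p'_surj p'_ker]]].
have [f [g [fg /(_ _ _ form form') phiE]]] :=
  cell_module_equiv lamD lamP W_cell W'_cell.
apply: (quotient_equiv fg p_surj p'_surj) => x.
rewrite p_ker p'_ker; split=> rad y; last by rewrite -phiE.
(* Every vector of [W'] has the form [f (g y)], so pairing to 0 with all of [W] suffices. *)
by rewrite -(sl_gK fg y) phiE.
Qed.

End CellRestriction.

Theorem theorem6p20
  (R : fieldType) (charR0 : [pchar R] =i pred0)
  (q : R) (q_neq0 : q != 0) (q_neq1 : q != 1)
  (e : nat) (q_e : is_quantum_char q e)
  (r n : nat) (r_ge2 : (2 <= r)%N) (n_ge3 : (3 <= n)%N)
  (j : 'I_r -> Zmod e)
  (j_far : forall a b, a != b -> (2 < Idist (j a) (j b))%N)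
  (w : word_family r n) (w_official : official w)
  (w' : word_family 2 n) (w'_official : official w')
  (u v : 'I_r) (u_lt_v : (u < v)%N)
  (lam mu : onecol r n) (lam_notD : ~~ in_D lam) (mu_notD : ~~ in_D mu)
  (lam_uv : forall l, l != u -> l != v -> lam l = 0%N)
  (mu_uv : forall l, l != u -> l != v -> mu l = 0%N)
  (lam' mu' : onecol 2 n)
  (lam'_uv : lam' =1 pair_ord (lam u) (lam v))
  (mu'_uv : mu' =1 pair_ord (mu u) (mu v))
  (Wlam : lmodType (TL R (sum_fund_weights j) n)) (Clam : Std lam -> Wlam)
  (Wlam_cell : is_cell_module w Clam)
  (Wmu : lmodType (TL R (sum_fund_weights j) n)) (Cmu : Std mu -> Wmu)
  (Wmu_cell : is_cell_module w Cmu)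
  (Lmu : lmodType (TL R (sum_fund_weights j) n))
  (Lmu_head : is_cell_head w Cmu Lmu)
  (Wlam' : lmodType (TL R (sum_fund_weights (pair_ord (j u) (j v))) n))
  (Clam' : Std lam' -> Wlam') (Wlam'_cell : is_cell_module w' Clam')
  (Wmu' : lmodType (TL R (sum_fund_weights (pair_ord (j u) (j v))) n))
  (Cmu' : Std mu' -> Wmu') (Wmu'_cell : is_cell_module w' Cmu')
  (Lmu' : lmodType (TL R (sum_fund_weights (pair_ord (j u) (j v))) n))
  (Lmu'_head : is_cell_head w' Cmu' Lmu') :
  comp_mult Wlam Lmu = comp_mult Wlam' Lmu'.
Proof.
have neq_uv : u != v by rewrite -val_eqE ltn_eqF.
have [pi [pi_surj pi_scal pi_psi pi_idem]] := tl_restriction R n j_far neq_uv.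
(* Totality on the side of the two-component algebra is [pi_surj]. *)
have relT : total_rel (fun a b => pi a = b) by split=> [a|//]; exists (pi a).
have lamP : restricts u v lam lam' by split.
have muP : restricts u v mu mu' by split.
have [f [g [fg _]]] := cell_module_equiv j_far u_lt_v w_official w'_official
  pi_scal pi_psi pi_idem lam_notD lamP Wlam_cell Wlam'_cell.
have [h [h' hh]] := cell_head_equiv j_far u_lt_v w_official w'_official
  pi_scal pi_psi pi_idem mu_notD muP pi_surj Wmu_cell Wmu'_cell Lmu_head Lmu'_head.
exact: comp_mult_equiv relT fg hh.
Qed.
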